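(* Let $M=\mathbb R$ or $M=\mathbb S^1$, let $p$ be a smooth function on $(0,\infty)$, let $\rho_0>0$ be a smooth function on $M$, and let $c>0$. The diffeomorphism equation of isentropic gas dynamics, $$\rho_0 \gamma_{tt} - p'\left(\frac{\rho_0}{\gamma_x}\right)\frac{\rho_0}{\gamma_x^2}\, \gamma_{xx} + p'\left(\frac{\rho_0}{\gamma_x}\right)\frac{\rho_0'}{\gamma_x} =0,$$ is the equation for extremals $\gamma$ (of class $\mathcal C^2$ with $\gamma_x>0$) of the action $$\mathfrak b(\gamma;\rho_0)=\int_0^c\int_M b\big(\gamma_t\circ\gamma^{-1},\gamma_x\circ\gamma^{-1},\rho_0\circ\gamma^{-1}\big)\,dx\,dt$$ with $$b(\gamma_t,\gamma_x,\rho_0)=\frac{\rho_0(x)\gamma_t^2}{2\gamma_x}+\frac1{\gamma_x}\int^{\gamma_x}p\left(\frac{\rho_0(x)}{\sigma}\right)d\sigma .$$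
   Context: For each $t$, $\gamma(\cdot,t)$ is a diffeomorphism of $M$, and $\gamma^{-1}$ is its inverse in the space variable at fixed $t$. The notation $\int^{\gamma_x}$ denotes the integral from an arbitrary fixed positive constant to $\gamma_x$. After the change of variables given by $\gamma$, the action is $$\mathfrak b(\gamma;\rho_0)=\int_0^c\int_M b(\gamma_t,\gamma_x,\rho_0)\,\gamma_x\,dx\,dt .$$ An extremal is a critical point: $\frac{d}{d\varepsilon}\int_0^c\int_M b(\gamma_t+\varepsilon\zeta_t,\gamma_x+\varepsilon\zeta_x,\rho_0)(\gamma_x+\varepsilon\zeta_x)\,dx\,dt\,\big|_{\varepsilon=0}=0$ for all smooth $\zeta$ compactly supported in $(0,c)\times M$ (the integrand being differentiated and integrated over the support of $\zeta$), with $\rho_0$ held fixed. *)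

(* Defs.v *)
From Stdlib Require Import Reals Lra.
From Coquelicot Require Import Coquelicot.
Open Scope R_scope.

(* The real line, or the circle R / L Z of an arbitrary circumference L > 0.
   Everything on the circle is written on its universal cover R: functions are
   L-periodic, and an orientation-preserving diffeomorphism is represented by a
   lift f with f (x + L) = f x + L. *)
Inductive space : Type :=
| Line : space
| Circle : posreal -> space.

Definition function_on (M : space) (f : R -> R) : Prop :=
  match M with
  | Line => True
  | Circle L => forall x, f (x + L) = f x
  end.

Definition map_on (M : space) (f : R -> R) : Prop :=
  match M with
  | Line => True
  | Circle L => forall x, f (x + L) = f x + L
  end.

Definition smooth_on (D : R -> Prop) (f : R -> R) : Prop :=
  forall (n : nat) (x : R), D x -> ex_derive_n f n x.

Definition class_C2 (f : R -> R) : Prop :=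
  forall x, ex_derive_n f 1 x /\ ex_derive_n f 2 x /\ continuous (Derive_n f 2) x.

Definition diffeomorphism (M : space) (f : R -> R) : Prop :=
  map_on M f /\ class_C2 f /\
  exists g : R -> R,
    class_C2 g /\ (forall x, g (f x) = x) /\ (forall y, f (g y) = y).

(* Functions of (x, t) take the space variable first. *)
Definition dx (f : R -> R -> R) (x t : R) : R := Derive (fun y => f y t) x.
Definition dt (f : R -> R -> R) (x t : R) : R := Derive (fun s => f x s) t.

(* ex_diff_n at every point of an open set says that all mixed partial
   derivatives up to order n exist and are continuous on that set. *)
Definition class_C2_on_strip (c : R) (f : R -> R -> R) : Prop :=
  forall x t, 0 < t < c -> ex_diff_n f 2 x t.

Definition smooth2 (f : R -> R -> R) : Prop :=
  forall (n : nat) (x t : R), ex_diff_n f n x t.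

(* s0 is the constant from which the indefinite integral is taken; r, gt, gx
   stand for the values of rho0, gamma_t, gamma_x. *)
Definition density (p : R -> R) (s0 gt gx r : R) : R :=
  r * gt ^ 2 / (2 * gx) + 1 / gx * RInt (fun s => p (r / s)) s0 gx.

(* The action over the window [x1, x2] x [t1, t2], after the change of variables
   given by the diffeomorphism, as a functional of the two derivatives gt, gx. *)
Definition action (p : R -> R) (s0 : R) (rho0 : R -> R) (x1 x2 t1 t2 : R)
    (gt gx : R -> R -> R) : R :=
  RInt (fun t =>
    RInt (fun x => density p s0 (gt x t) (gx x t) (rho0 x) * gx x t) x1 x2) t1 t2.

(* A window is a compact box in (0, c) x M; for the circle it covers all of M,
   as one fundamental domain. *)
Definition window (M : space) (c x1 x2 t1 t2 : R) : Prop :=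
  0 < t1 < t2 /\ t2 < c /\
  match M with
  | Line => x1 < x2
  | Circle L => x2 = x1 + L
  end.

Definition supported_in (M : space) (x1 x2 t1 t2 : R) (z : R -> R -> R) : Prop :=
  forall x t, z x t <> 0 ->
    t1 <= t <= t2 /\
    match M with
    | Line => x1 <= x <= x2
    | Circle _ => True
    end.

(* A compactly supported zeta on (0, c) x M is extended by zero in t, and its
   support lies in some window.  Outside the support the integrand does not
   depend on eps, so the window over which one integrates is immaterial; the
   full integral over (0, c) x M need not converge. *)
Definition extremal (M : space) (p : R -> R) (s0 : R) (rho0 : R -> R) (c : R)
    (gamma : R -> R -> R) : Prop :=
  forall zeta : R -> R -> R,
    smooth2 zeta ->
    (forall t, function_on M (fun x => zeta x t)) ->
    forall x1 x2 t1 t2 : R,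
      window M c x1 x2 t1 t2 ->
      supported_in M x1 x2 t1 t2 zeta ->
      is_derive (fun eps =>
        action p s0 rho0 x1 x2 t1 t2
          (fun x t => dt gamma x t + eps * dt zeta x t)
          (fun x t => dx gamma x t + eps * dx zeta x t)) 0 0.

Definition diffeomorphism_equation (p rho0 : R -> R) (c : R)
    (gamma : R -> R -> R) : Prop :=
  forall x t, 0 < t < c ->
    let gx := dx gamma x t in
    rho0 x * dt (dt gamma) x t
    - Derive p (rho0 x / gx) * (rho0 x / gx ^ 2) * dx (dx gamma) x t
    + Derive p (rho0 x / gx) * (Derive rho0 x / gx) = 0.

Lemma RInt_pressure (p : R -> R) (s0 r a : R) :
  (forall u, 0 < u -> continuous p u) -> 0 < s0 -> 0 < r -> 0 < a ->
  RInt (fun s => p (r / s)) s0 a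
  = r * (RInt (fun u => p (/ u)) 1 (a / r) - RInt (fun u => p (/ u)) 1 (s0 / r)).
Proof.
intros Hp Hs Hr Ha.
assert (Hc : forall u, 0 < u -> continuous (fun u => p (/ u)) u).
{ intros u Hu. apply (continuous_comp Rinv p).
  - apply continuous_Rinv; lra.
  - apply Hp, Rinv_0_lt_compat, Hu. }
assert (Hi : forall u v, 0 < u -> 0 < v -> ex_RInt (fun u => p (/ u)) u v).
{ intros u v Hu Hv. apply (ex_RInt_continuous (V := R_CompleteNormedModule)).
  intros z [Hz _]. apply Hc. apply Rlt_le_trans with (2 := Hz).
  now apply Rmin_glb_lt. }
assert (Har : 0 < a / r) by now apply Rdiv_lt_0_compat.
assert (Hsr : 0 < s0 / r) by now apply Rdiv_lt_0_compat.
assert (H1 : RInt (fun u => p (/ u)) 1 (a / r) - RInt (fun u => p (/ u)) 1 (s0 / r)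
             = RInt (fun u => p (/ u)) (s0 / r) (a / r)).
{ generalize (RInt_Chasles (fun u => p (/ u)) 1 (s0 / r) (a / r)
    (Hi _ _ Rlt_0_1 Hsr) (Hi _ _ Hsr Har)).
  unfold plus; simpl. intros E. rewrite <- E. lra. }
rewrite H1.
generalize (RInt_comp_lin (fun u => p (/ u)) (/ r) 0 s0 a).
replace (/ r * s0 + 0) with (s0 / r) by (field; lra).
replace (/ r * a + 0) with (a / r) by (field; lra).
intros E. rewrite <- E by now apply Hi.
rewrite RInt_scal.
- unfold scal; simpl; unfold mult; simpl.
  rewrite <- Rmult_assoc, Rinv_r, Rmult_1_l by lra.
  apply RInt_ext. intros s [Hs1 _].
  assert (0 < s) by (apply Rlt_trans with (2 := Hs1); now apply Rmin_glb_lt).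
  f_equal. field. lra.
- apply (ex_RInt_continuous (V := R_CompleteNormedModule)).
  intros z [Hz _].
  assert (0 < z) by (apply Rlt_le_trans with (2 := Hz); now apply Rmin_glb_lt).
  apply (continuous_comp (fun s => / r * s + 0) (fun u => p (/ u))).
  + apply (continuous_plus (V := R_NormedModule)).
    * apply (continuous_mult (K := R_AbsRing)).
      apply continuous_const. apply continuous_id.
    * apply continuous_const.
  + apply Hc. rewrite Rplus_0_r. apply Rmult_lt_0_compat; trivial.
    now apply Rinv_0_lt_compat.
Qed.

Lemma continuous_density (p : R -> R) (s0 : R) (v w r : R -> R) (x : R) :
  (forall u, 0 < u -> continuous p u) -> 0 < s0 ->
  (forall y, 0 < w y) -> (forall y, 0 < r y) ->
  continuous v x -> continuous w x -> continuous r x ->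
  continuous (fun y => density p s0 (v y) (w y) (r y)) x.
Proof.
intros Hp Hs Hw Hr Cv Cw Cr.
set (Q := fun a : R => RInt (fun u => p (/ u)) 1 a : R).
assert (CQ : forall a, 0 < a -> continuous Q a).
{ intros a Ha. apply (ex_derive_continuous (K := R_AbsRing) (V := R_NormedModule)).
  assert (Hc : forall u, 0 < u -> continuous (fun u => p (/ u)) u).
  { intros u Hu. apply (continuous_comp Rinv p).
    - apply continuous_Rinv; lra.
    - apply Hp, Rinv_0_lt_compat, Hu. }
  exists (p (/ a)). apply (is_derive_RInt (V := R_NormedModule) (fun u => p (/ u)) Q 1).
  - exists (mkposreal a Ha). intros b Hb.
    assert (0 < b).
    { unfold ball in Hb; simpl in Hb; unfold AbsRing_ball, abs, minus, plus, opp in Hb;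
      simpl in Hb. apply Rabs_def2 in Hb. lra. }
    apply (RInt_correct (V := R_CompleteNormedModule)).
    apply (ex_RInt_continuous (V := R_CompleteNormedModule)). intros z [Hz _].
    apply Hc. apply Rlt_le_trans with (2 := Hz). apply Rmin_glb_lt; lra.
  - now apply Hc. }
apply continuous_ext with (fun y =>
  r y * (v y * v y) * / (2 * w y)
  + / w y * (r y * (Q (w y * / r y) - Q (s0 * / r y)))).
{ intros y. unfold density, Q. rewrite RInt_pressure by auto.
  unfold Rdiv. match goal with |- ?a = ?b => change (@eq R a b) end; ring. }
assert (Cir : continuous (fun y => / r y) x).
{ apply (continuous_comp r Rinv); trivial. apply continuous_Rinv.
  specialize (Hr x); lra. }
assert (Ciw : continuous (fun y => / w y) x).
{ apply (continuous_comp w Rinv); trivial. apply continuous_Rinv.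
  specialize (Hw x); lra. }
assert (Ciw2 : continuous (fun y => / (2 * w y)) x).
{ apply (continuous_comp (fun y => 2 * w y) Rinv).
  - apply (continuous_mult (K := R_AbsRing)); trivial. apply continuous_const.
  - apply continuous_Rinv. specialize (Hw x); lra. }
assert (CQ1 : continuous (fun y => Q (w y * / r y)) x).
{ apply (continuous_comp (fun y => w y * / r y) Q).
  - now apply (continuous_mult (K := R_AbsRing)).
  - apply CQ, Rdiv_lt_0_compat; auto. }
assert (CQ2 : continuous (fun y => Q (s0 * / r y)) x).
{ apply (continuous_comp (fun y => s0 * / r y) Q).
  - apply (continuous_mult (K := R_AbsRing)); trivial. apply continuous_const.
  - apply CQ, Rdiv_lt_0_compat; auto. }
clearbody Q.
apply (continuous_plus (V := R_NormedModule)).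
- apply (continuous_mult (K := R_AbsRing)); trivial.
  apply (continuous_mult (K := R_AbsRing)); trivial.
  now apply (continuous_mult (K := R_AbsRing)).
- apply (continuous_mult (K := R_AbsRing)); trivial.
  apply (continuous_mult (K := R_AbsRing)); trivial.
  now apply (continuous_minus (V := R_NormedModule)).
Qed.

Lemma continuous_2d_slice (f : R -> R -> R) (x t : R) :
  continuity_2d_pt f x t -> continuous (fun y => f y t) x.
Proof.
intros H. apply filterlim_locally. intros eps.
destruct (H eps) as [d Hd]. exists d. intros y Hy.
apply Hd.
- exact Hy.
- rewrite Rminus_diag. rewrite Rabs_R0. apply cond_pos.
Qed.

(* The change of variables: on each window, [action] is the integral of
   b (gamma_t o gamma^-1, gamma_x o gamma^-1, rho0 o gamma^-1), with the inverse
   taken in x at fixed t, over the image of the window. *)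
Lemma action_change_of_variables (p : R -> R) (s0 : R) (rho0 : R -> R) (c : R)
    (gamma ginv : R -> R -> R) (x1 x2 t1 t2 : R) :
  smooth_on (fun s => 0 < s) p -> 0 < s0 ->
  smooth_on (fun _ => True) rho0 -> (forall x, 0 < rho0 x) ->
  class_C2_on_strip c gamma ->
  (forall x t, 0 < t < c -> 0 < dx gamma x t) ->
  (forall t, 0 < t < c -> class_C2 (fun y => ginv y t)) ->
  (forall x t, 0 < t < c -> ginv (gamma x t) t = x) ->
  0 < t1 <= t2 -> t2 < c ->
  RInt (fun t => RInt (fun y =>
      density p s0 (dt gamma (ginv y t) t) (dx gamma (ginv y t) t)
        (rho0 (ginv y t))) (gamma x1 t) (gamma x2 t)) t1 t2
  = action p s0 rho0 x1 x2 t1 t2 (dt gamma) (dx gamma).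
Proof.
intros Hp Hs Hrs Hr Hg Hgx Hi Hl [Ht1 Ht12] Ht2.
apply RInt_ext. intros t [H1 H2].
rewrite Rmin_left in H1 by lra. rewrite Rmax_right in H2 by lra.
assert (Ht : 0 < t < c) by lra.
rewrite <- (RInt_comp (V := R_CompleteNormedModule) _
  (fun x => gamma x t) (fun x => dx gamma x t)).
- apply RInt_ext. intros x _. unfold scal; simpl; unfold mult; simpl.
  rewrite Hl by exact Ht. apply Rmult_comm.
- intros x _.
  apply (continuous_comp (fun y => ginv y t)
    (fun z => density p s0 (dt gamma z t) (dx gamma z t) (rho0 z))).
  + apply (ex_derive_continuous (K := R_AbsRing) (V := R_NormedModule)). apply (proj1 (Hi t Ht _)).
  + rewrite Hl by exact Ht.
    destruct (Hg x t Ht) as (_ & _ & _ & [Cx _] & [Ct _]).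
    apply continuous_density; auto.
    * intros u Hu. apply (ex_derive_continuous (K := R_AbsRing) (V := R_NormedModule)).
      exact (Hp 1%nat u Hu).
    * now apply continuous_2d_slice.
    * now apply continuous_2d_slice.
    * apply (ex_derive_continuous (K := R_AbsRing) (V := R_NormedModule)). exact (Hrs 1%nat x I).
- intros x _. destruct (Hg x t Ht) as (_ & Dx & _ & [Cx _] & _). split.
  + apply Derive_correct. exact Dx.
  + now apply continuous_2d_slice.
Qed.

(* Main.v *)
Require Import Defs.
From Stdlib Require Import Reals Lra Factorial.
From Coquelicot Require Import Coquelicot.
Open Scope R_scope.

(** After the change of variables the integrand is
    [rho0 gamma_t^2 / 2 + int^{gamma_x} p (rho0 / s) ds], whose first variation is
    [rho0 gamma_t zeta_t + p (rho0 / gamma_x) zeta_x]; integrating by parts, this is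
    minus the integral of [zeta] times the left-hand side of the diffeomorphism
    equation.  To differentiate under the double integral, the second-order
    remainder in [eps] is bounded uniformly on the window.  The time derivative is
    integrated by parts after the integration in [x], so Fubini is not needed.  The
    converse is the fundamental lemma of the calculus of variations, with test
    functions built from [exp (- 1 / x)]. *)

(** * Double integrals over a box *)

(** The pressure integral has an integrand that varies with the point through rho0. Scaling by rho0
    turns it into rho0 times an increment of one fixed function of gamma_x / rho0, so a single
    Taylor estimate in one variable controls the whole window. Since [p] is smooth only on the
    positive half-line, that estimate must stay away from 0: compactness gives a positive lower
    bound for gamma_x / rho0, and [eps] is restricted so that at least half of it survives.

    Regularity of gamma is available only on the open strip 0 < t < c, so bounds are taken on closed
    boxes strictly inside it. The boundary terms in time vanish on both spaces; in space they vanish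
    on the line and cancel by periodicity on the circle. Both implications rest on one formula for
    the derivative at [eps] = 0, which holds whether or not gamma is extremal. *)

Definition RInt2 (f : R -> R -> R) (x1 x2 t1 t2 : R) : R :=
  RInt (fun t => RInt (fun x => f x t) x1 x2) t1 t2.

(** Closed in x, where one integrates over the whole range, but open in t, because gamma is
    controlled only on an open time interval; the integrals run over some [t1, t2] strictly inside
    it. *)
Definition continuous_box (f : R -> R -> R) (x1 x2 a b : R) : Prop :=
  forall x t, x1 <= x <= x2 -> a < t < b -> continuity_2d_pt f x t.

Lemma continuity_2d_pt_swap (f : R -> R -> R) (x t : R) :
  continuity_2d_pt f x t -> continuity_2d_pt (fun u v => f v u) t x.
Proof.
intros H eps. destruct (H eps) as [d Hd]. exists d. intros u v Hu Hv.
now apply Hd.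
Qed.

Lemma continuity_2d_pt_comp (g : R -> R) (f : R -> R -> R) (x t : R) :
  continuous g (f x t) -> continuity_2d_pt f x t ->
  continuity_2d_pt (fun u v => g (f u v)) x t.
Proof.
intros Hg. apply continuity_1d_2d_pt_comp. now apply continuity_pt_filterlim.
Qed.

Lemma continuity_2d_pt_space (g : R -> R) (x t : R) :
  continuous g x -> continuity_2d_pt (fun u _ => g u) x t.
Proof.
intros Hg. apply (continuity_2d_pt_comp g (fun u _ => u)); trivial.
apply continuity_2d_pt_id1.
Qed.

Lemma ex_RInt_continuous_le (f : R -> R) (a b : R) :
  a <= b -> (forall x, a <= x <= b -> continuous f x) -> ex_RInt f a b.
Proof.
intros Hab H. apply (ex_RInt_continuous (V := R_CompleteNormedModule)).
intros z. rewrite Rmin_left, Rmax_right by trivial. apply H.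
Qed.

Lemma locally_between (P : R -> Prop) (a b t : R) :
  a < t < b -> (forall s, a < s < b -> P s) -> locally t P.
Proof.
intros Ht H. assert (Hd : 0 < Rmin (t - a) (b - t)) by (apply Rmin_glb_lt; lra).
exists (mkposreal _ Hd). intros s Hs.
unfold ball in Hs; simpl in Hs.
unfold AbsRing_ball, abs, minus, plus, opp in Hs; simpl in Hs.
apply Rabs_def2 in Hs.
pose proof (Rmin_l (t - a) (b - t)). pose proof (Rmin_r (t - a) (b - t)).
apply H; lra.
Qed.

Lemma ex_RInt_box (f : R -> R -> R) (x1 x2 a b t : R) :
  x1 <= x2 -> continuous_box f x1 x2 a b -> a < t < b ->
  ex_RInt (fun x => f x t) x1 x2.
Proof.
intros Hx H Ht. apply ex_RInt_continuous_le; trivial.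
intros x Hx'. apply continuous_2d_slice. now apply H.
Qed.

Lemma continuous_RInt_box (f : R -> R -> R) (x1 x2 a b t : R) :
  x1 <= x2 -> continuous_box f x1 x2 a b -> a < t < b ->
  continuous (fun s => RInt (fun x => f x s) x1 x2) t.
Proof.
intros Hx H Ht. apply filterlim_locally. intros eps.
(* The summand 1 keeps the denominator positive when x1 = x2. *)
assert (He : 0 < eps / (2 * (x2 - x1 + 1))).
{ apply Rdiv_lt_0_compat. apply cond_pos. lra. }
destruct (uniform_continuity_2d_1d f x1 x2 t (fun x Hx' => H x t Hx' Ht)
  (mkposreal _ He)) as [d Hd].
simpl in Hd.
assert (L : locally t (fun s => a < s < b)) by (apply (locally_between _ a b); auto).
generalize (filter_and _ _ L (locally_ball t d)). apply filter_imp.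
intros s [Hs Hsd].
unfold ball in Hsd |- *; simpl in Hsd |- *.
unfold AbsRing_ball, abs, minus, plus, opp in Hsd |- *; simpl in Hsd |- *.
apply Rabs_def2 in Hsd.
assert (E1 := ex_RInt_box f x1 x2 a b s Hx H Hs).
assert (E2 := ex_RInt_box f x1 x2 a b t Hx H Ht).
generalize (RInt_minus (V := R_CompleteNormedModule) _ _ _ _ E1 E2).
unfold minus, plus, opp; simpl. intros E. rewrite <- E.
apply Rle_lt_trans with ((x2 - x1) * (eps / (2 * (x2 - x1 + 1)))).
- apply abs_RInt_le_const; trivial.
  + apply (ex_RInt_minus (V := R_NormedModule) _ _ _ _ E1 E2).
  + intros x Hx'. pose proof (cond_pos d) as Hdp. apply Rlt_le. apply Hd; try lra.
    rewrite Rminus_diag, Rabs_R0. apply cond_pos.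
- pose proof (cond_pos eps).
  apply Rmult_lt_reg_r with (2 * (x2 - x1 + 1)). lra.
  replace ((x2 - x1) * (eps / (2 * (x2 - x1 + 1))) * (2 * (x2 - x1 + 1)))
    with ((x2 - x1) * eps) by (field; lra).
  nra.
Qed.

Lemma ex_RInt_RInt_box (f : R -> R -> R) (x1 x2 a b t1 t2 : R) :
  x1 <= x2 -> a < t1 -> t1 <= t2 -> t2 < b -> continuous_box f x1 x2 a b ->
  ex_RInt (fun t => RInt (fun x => f x t) x1 x2) t1 t2.
Proof.
intros Hx Ha Ht Hb H. apply ex_RInt_continuous_le; trivial.
intros t Ht'. apply (continuous_RInt_box f x1 x2 a b); trivial. lra.
Qed.

Lemma RInt_lin (f g : R -> R) (l a b : R) :
  ex_RInt f a b -> ex_RInt g a b ->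
  RInt (fun x => f x + l * g x) a b = RInt f a b + l * RInt g a b.
Proof.
intros Hf Hg.
assert (Hlg := ex_RInt_scal (V := R_NormedModule) g a b l Hg).
rewrite (RInt_plus (V := R_CompleteNormedModule) f (fun x => l * g x) a b Hf Hlg
  : RInt (fun x => f x + l * g x) a b = _).
apply f_equal. exact (RInt_scal (V := R_CompleteNormedModule) g a b l Hg).
Qed.

Lemma continuous_box_lin (f g : R -> R -> R) (l x1 x2 a b : R) :
  continuous_box f x1 x2 a b -> continuous_box g x1 x2 a b ->
  continuous_box (fun x t => f x t + l * g x t) x1 x2 a b.
Proof.
intros Hf Hg x t Hx Ht. apply continuity_2d_pt_plus. now apply Hf.
apply continuity_2d_pt_mult. apply continuity_2d_pt_const. now apply Hg.
Qed.

(** The shape f + l g serves for sums, differences and multiples alike, with l = 1, l = -1, or g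
    added to a multiple of itself. *)
Lemma RInt2_lin (f g : R -> R -> R) (l x1 x2 a b t1 t2 : R) :
  x1 <= x2 -> a < t1 -> t1 <= t2 -> t2 < b ->
  continuous_box f x1 x2 a b -> continuous_box g x1 x2 a b ->
  RInt2 (fun x t => f x t + l * g x t) x1 x2 t1 t2
  = RInt2 f x1 x2 t1 t2 + l * RInt2 g x1 x2 t1 t2.
Proof.
intros Hx Ha Ht Hb Hf Hg. unfold RInt2.
rewrite <- RInt_lin by (apply (ex_RInt_RInt_box _ _ _ a b); trivial).
apply RInt_ext. intros t. rewrite Rmin_left, Rmax_right by trivial. intros Ht'.
apply RInt_lin; apply (ex_RInt_box _ _ _ a b); trivial; lra.
Qed.

Lemma RInt2_ext (f g : R -> R -> R) (x1 x2 t1 t2 : R) :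
  x1 <= x2 -> t1 <= t2 ->
  (forall x t, x1 <= x <= x2 -> t1 <= t <= t2 -> f x t = g x t) ->
  RInt2 f x1 x2 t1 t2 = RInt2 g x1 x2 t1 t2.
Proof.
intros Hx Ht H. apply RInt_ext. intros t.
rewrite Rmin_left, Rmax_right by trivial. intros Ht'.
apply RInt_ext. intros x. rewrite Rmin_left, Rmax_right by trivial. intros Hx'.
apply H; lra.
Qed.

Lemma RInt2_abs_le (f : R -> R -> R) (x1 x2 a b t1 t2 K : R) :
  x1 <= x2 -> a < t1 -> t1 <= t2 -> t2 < b -> continuous_box f x1 x2 a b ->
  (forall x t, x1 <= x <= x2 -> t1 <= t <= t2 -> Rabs (f x t) <= K) ->
  Rabs (RInt2 f x1 x2 t1 t2) <= (t2 - t1) * ((x2 - x1) * K).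
Proof.
intros Hx Ha Ht Hb Hf HK. apply abs_RInt_le_const; trivial.
- now apply (ex_RInt_RInt_box _ _ _ a b).
- intros t Ht'. apply abs_RInt_le_const; trivial.
  + apply (ex_RInt_box _ _ _ a b); trivial; lra.
  + intros x Hx'. now apply HK.
Qed.

(** * Differentiation under the double integral *)

Lemma is_derive_quadratic_remainder (f : R -> R) (l d K : R) :
  0 < d ->
  (forall e, Rabs e < d -> Rabs (f e - f 0 - e * l) <= K * e ^ 2) ->
  is_derive f 0 l.
Proof.
intros Hd H. apply is_derive_Reals. intros eps Heps.
(* The difference quotient is within K |h| of l; [Rabs K + 1] is a positive bound for K whatever its
   sign. *)
assert (Hd' : 0 < Rmin d (eps / (Rabs K + 1))).
{ apply Rmin_glb_lt; trivial. apply Rdiv_lt_0_compat; trivial.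
  pose proof (Rabs_pos K). lra. }
exists (mkposreal _ Hd'). intros h Hh Hhd. simpl in Hhd.
assert (H1 : Rabs h < d) by (apply Rlt_le_trans with (1 := Hhd); apply Rmin_l).
assert (H2 : Rabs h < eps / (Rabs K + 1))
  by (apply Rlt_le_trans with (1 := Hhd); apply Rmin_r).
specialize (H h H1). rewrite Rplus_0_l.
replace ((f h - f 0) / h - l) with ((f h - f 0 - h * l) / h) by (field; trivial).
rewrite Rabs_div by trivial.
assert (Hp : 0 < Rabs h) by now apply Rabs_pos_lt.
apply Rmult_lt_reg_r with (Rabs h); trivial.
unfold Rdiv. rewrite Rmult_assoc, Rinv_l, Rmult_1_r by lra.
apply Rle_lt_trans with (1 := H).
rewrite <- (pow2_abs h).
pose proof (Rle_abs K) as HK1. pose proof (Rabs_pos K) as HK2.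
assert (HK3 : Rabs h * (Rabs K + 1) < eps).
{ apply Rmult_lt_reg_r with (/ (Rabs K + 1)).
  - apply Rinv_0_lt_compat; lra.
  - rewrite Rmult_assoc, Rinv_r, Rmult_1_r by lra. exact H2. }
nra.
Qed.

(** A remainder bounded by K e^2 uniformly on the box integrates to at most the area times K e^2,
    which is again a quadratic remainder. Only the expansion at e = 0 enters, not derivatives in e
    at neighbouring values. *)
Lemma is_derive_RInt2 (H : R -> R -> R -> R) (k : R -> R -> R)
    (x1 x2 a b t1 t2 d K : R) :
  x1 <= x2 -> a < t1 -> t1 <= t2 -> t2 < b -> 0 < d ->
  (forall e, Rabs e < d -> continuous_box (H e) x1 x2 a b) ->
  continuous_box k x1 x2 a b ->
  (forall e x t, Rabs e < d -> x1 <= x <= x2 -> t1 <= t <= t2 ->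
    Rabs (H e x t - H 0 x t - e * k x t) <= K * e ^ 2) ->
  is_derive (fun e => RInt2 (H e) x1 x2 t1 t2) 0 (RInt2 k x1 x2 t1 t2).
Proof.
intros Hx Ha Ht Hb Hd HH Hk HK.
apply is_derive_quadratic_remainder with d ((t2 - t1) * ((x2 - x1) * K)); trivial.
intros e He.
assert (H0 : continuous_box (H 0) x1 x2 a b) by (apply HH; now rewrite Rabs_R0).
assert (He' := HH e He).
replace (RInt2 (H e) x1 x2 t1 t2 - RInt2 (H 0) x1 x2 t1 t2
         - e * RInt2 k x1 x2 t1 t2)
  with (RInt2 (H e) x1 x2 t1 t2 + -1 * RInt2 (H 0) x1 x2 t1 t2
         + - e * RInt2 k x1 x2 t1 t2) by ring.
assert (H1 := continuous_box_lin _ _ (-1) _ _ _ _ He' H0).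
rewrite <- !(RInt2_lin _ _ _ x1 x2 a b) by trivial.
replace ((t2 - t1) * ((x2 - x1) * K) * e ^ 2)
  with ((t2 - t1) * ((x2 - x1) * (K * e ^ 2))) by ring.
apply RInt2_abs_le with a b; trivial.
- now apply (continuous_box_lin (fun x t => H e x t + -1 * H 0 x t)).
- intros x t Hx' Ht'.
  replace (H e x t + -1 * H 0 x t + - e * k x t)
    with (H e x t - H 0 x t - e * k x t) by ring.
  now apply HK.
Qed.

(** * Bounds on compact boxes and a first-order Taylor estimate *)

Lemma bounded_box (f : R -> R -> R) (x1 x2 t1 t2 : R) :
  (forall x t, x1 <= x <= x2 -> t1 <= t <= t2 -> continuity_2d_pt f x t) ->
  exists K, 0 < K /\
    forall x t, x1 <= x <= x2 -> t1 <= t <= t2 -> Rabs (f x t) <= K.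
Proof.
intros Hf.
assert (He : 0 < 1) by lra.
destruct (uniform_continuity_2d f x1 x2 t1 t2 Hf (mkposreal _ He)) as [d Hd].
simpl in Hd.
(* The gauge encodes the size of f: the covering lemma yields e > 0 such that every point is close
   to some (u, v) with e <= [delta] u v, hence |f u v| + 1 <= / e, while f varies by less than 1
   within distance d. *)
set (delta := fun u v : R => mkposreal (Rmin d (/ (Rabs (f u v) + 1)))
  (Rmin_glb_lt _ _ _ (cond_pos d)
    (Rinv_0_lt_compat _ (Rplus_le_lt_0_compat _ _ (Rabs_pos (f u v)) Rlt_0_1)))).
destruct (compactness_value_2d x1 x2 t1 t2 delta) as [e Hed].
assert (Hep := cond_pos e).
exists (/ e + 1). split.
{ apply Rinv_0_lt_compat in Hep. lra. }
(* The covering lemma asserts the point (u, v) only under a double negation, so the goal is first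
   brought to [False]. *)
intros x t Hx Ht. apply Rnot_lt_le. intros Hlt.
apply (Hed x t Hx Ht). intros (u & v & Hu & Hv & H1 & H2 & H3).
simpl in H1, H2, H3.
assert (H4 : Rabs (f x t - f u v) < 1).
{ apply Hd; trivial; (eapply Rlt_le_trans; [eassumption | apply Rmin_l]). }
assert (H5 : e <= / (Rabs (f u v) + 1)).
{ apply Rle_trans with (1 := H3). apply Rmin_r. }
assert (Hp := Rabs_pos (f u v)).
assert (H6 : Rabs (f u v) + 1 <= / e).
{ rewrite <- (Rinv_inv (Rabs (f u v) + 1)). apply Rinv_le_contravar; trivial. }
pose proof (Rabs_triang_inv (f x t) (f u v)). lra.
Qed.

(** An upper bound for 1 / f is a positive lower bound for f. *)
Lemma bounded_below_box (f : R -> R -> R) (x1 x2 t1 t2 : R) :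
  (forall x t, x1 <= x <= x2 -> t1 <= t <= t2 ->
    continuity_2d_pt f x t /\ 0 < f x t) ->
  exists m, 0 < m /\
    forall x t, x1 <= x <= x2 -> t1 <= t <= t2 -> m <= f x t.
Proof.
intros Hf.
destruct (bounded_box (fun x t => / f x t) x1 x2 t1 t2) as [K [HK H]].
{ intros x t Hx Ht. destruct (Hf x t Hx Ht). apply continuity_2d_pt_inv; trivial. lra. }
exists (/ K). split. now apply Rinv_0_lt_compat.
intros x t Hx Ht. destruct (Hf x t Hx Ht) as [_ Hp].
rewrite <- (Rinv_inv (f x t)). apply Rinv_le_contravar.
- now apply Rinv_0_lt_compat.
- apply Rle_trans with (2 := H x t Hx Ht). apply Rle_abs.
Qed.

Lemma continuous_bounded (f : R -> R) (a b : R) :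
  (forall x, a <= x <= b -> continuous f x) ->
  exists K, 0 < K /\ forall x, a <= x <= b -> Rabs (f x) <= K.
Proof.
intros Hf. destruct (bounded_box (fun x _ => f x) a b 0 0) as [K [HK H]].
- intros x t Hx _. now apply continuity_2d_pt_space, Hf.
- exists K. split; trivial. intros x Hx. apply (H x 0); trivial. lra.
Qed.

(** The mean value theorem is used twice, for f between x and y and for f1 between x and the
    intermediate point z, with |z - x| <= |y - x|. The constant is a bound for f2, without the
    factor 1/2 of the sharp estimate. *)
Lemma taylor1_remainder (f f1 f2 : R -> R) (a b : R) :
  (forall x, a <= x <= b -> is_derive f x (f1 x) /\ is_derive f1 x (f2 x)
     /\ continuous f2 x) ->
  exists K, 0 < K /\ forall x y, a <= x <= b -> a <= y <= b ->
    Rabs (f y - f x - (y - x) * f1 x) <= K * (y - x) ^ 2.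
Proof.
intros H.
destruct (continuous_bounded f2 a b) as [K [HK HB]].
{ intros x Hx. apply H, Hx. }
assert (D : forall (g dg : R -> R) x y, a <= x <= b -> a <= y <= b ->
  (forall z, a <= z <= b -> is_derive g z (dg z)) ->
  exists z, Rmin x y <= z <= Rmax x y /\ g y - g x = dg z * (y - x)).
{ intros g dg x y Hx Hy Hg.
  assert (I : forall z, Rmin x y <= z <= Rmax x y -> a <= z <= b).
  { intros z [H1 H2]. split.
    - apply Rle_trans with (2 := H1). apply Rmin_glb; lra.
    - apply Rle_trans with (1 := H2). apply Rmax_lub; lra. }
  apply MVT_gen.
  - intros z Hz. apply Hg, I; lra.
  - intros z Hz. apply continuity_pt_filterlim.
    apply (ex_derive_continuous (K := R_AbsRing) (V := R_NormedModule)).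
    eexists. apply Hg, I, Hz. }
exists K. split; trivial. intros x y Hx Hy.
destruct (D f f1 x y Hx Hy) as [z [Hz E]].
{ intros z Hz. apply H, Hz. }
assert (Iz : a <= z <= b).
{ destruct Hz. split.
  - apply Rle_trans with (Rmin x y); trivial. apply Rmin_glb; lra.
  - apply Rle_trans with (Rmax x y); trivial. apply Rmax_lub; lra. }
destruct (D f1 f2 x z Hx Iz) as [w [Hw E']].
{ intros w Hw. apply H, Hw. }
assert (Iw : a <= w <= b).
{ destruct Hw. split.
  - apply Rle_trans with (Rmin x z); trivial. apply Rmin_glb; lra.
  - apply Rle_trans with (Rmax x z); trivial. apply Rmax_lub; lra. }
rewrite E. replace (f1 z * (y - x) - (y - x) * f1 x) with ((f1 z - f1 x) * (y - x)) by ring.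
rewrite E', !Rabs_mult, <- (pow2_abs (y - x)).
assert (Hzx : Rabs (z - x) <= Rabs (y - x)).
{ unfold Rmin, Rmax in Hz. destruct (Rle_dec x y).
  - rewrite !Rabs_pos_eq; lra.
  - rewrite !Rabs_left1; lra. }
specialize (HB w Iw).
pose proof (Rabs_pos (y - x)). pose proof (Rabs_pos (z - x)).
pose proof (Rabs_pos (f2 w)).
assert (Rabs (f2 w) * Rabs (z - x) <= K * Rabs (y - x)) by (apply Rmult_le_compat; trivial).
simpl. rewrite Rmult_1_r, <- Rmult_assoc.
apply Rmult_le_compat_r; trivial.
Qed.

(** * First variation of the action *)

(* In mass coordinates [w = gamma_x / rho0], [w] is the specific volume and
   [- pressure_primitive p w] the internal energy. *)
Definition pressure_primitive (p : R -> R) (y : R) : R :=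
  RInt (fun u => p (/ u)) 1 y.

Lemma smooth_on_continuous (D : R -> Prop) (f : R -> R) (x : R) :
  smooth_on D f -> D x -> continuous f x.
Proof.
intros H Hx. apply (ex_derive_continuous (K := R_AbsRing) (V := R_NormedModule)).
exact (H 1%nat x Hx).
Qed.

Lemma smooth_on_is_derive (D : R -> Prop) (f : R -> R) (x : R) :
  smooth_on D f -> D x -> is_derive f x (Derive f x).
Proof. intros H Hx. apply Derive_correct. exact (H 1%nat x Hx). Qed.

Lemma smooth_on_continuous_Derive (D : R -> Prop) (f : R -> R) (x : R) :
  smooth_on D f -> D x -> continuous (Derive f) x.
Proof.
intros H Hx. apply (ex_derive_continuous (K := R_AbsRing) (V := R_NormedModule)).
exact (H 2%nat x Hx).
Qed.

Lemma is_derive_pressure_Rinv (p : R -> R) (y : R) :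
  smooth_on (fun s => 0 < s) p -> 0 < y ->
  is_derive (fun u => p (/ u)) y (- / y ^ 2 * Derive p (/ y)).
Proof.
intros Hp Hy. apply (is_derive_comp (K := R_AbsRing) (V := R_NormedModule) p Rinv).
- apply (smooth_on_is_derive _ _ _ Hp). now apply Rinv_0_lt_compat.
- auto_derive. lra. field. lra.
Qed.

Lemma is_derive_pressure_primitive (p : R -> R) (y : R) :
  smooth_on (fun s => 0 < s) p -> 0 < y ->
  is_derive (pressure_primitive p) y (p (/ y)).
Proof.
intros Hp Hy.
assert (Hc : forall u, 0 < u -> continuous (fun u => p (/ u)) u).
{ intros u Hu. apply (ex_derive_continuous (K := R_AbsRing) (V := R_NormedModule)).
  eexists. now apply is_derive_pressure_Rinv. }
apply (is_derive_RInt (V := R_NormedModule) (fun u => p (/ u)) _ 1).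
- apply (locally_between _ 0 (y + 1)). lra. intros s Hs.
  apply (RInt_correct (V := R_CompleteNormedModule)).
  apply (ex_RInt_continuous (V := R_CompleteNormedModule)). intros z [Hz _].
  apply Hc. apply Rlt_le_trans with (2 := Hz). apply Rmin_glb_lt; lra.
- now apply Hc.
Qed.

(** The Jacobian gx cancels the factor 1 / gx of the density, and the substitution s = r u moves r
    from the integrand into the endpoints. *)
Lemma density_pressure_primitive (p : R -> R) (s0 gt gx r : R) :
  smooth_on (fun s => 0 < s) p -> 0 < s0 -> 0 < r -> 0 < gx ->
  density p s0 gt gx r * gx
  = / 2 * (r * (gt * gt))
    + r * (pressure_primitive p (gx * / r) - pressure_primitive p (s0 * / r)).
Proof.
intros Hp Hs Hr Hg. unfold density. rewrite RInt_pressure; trivial.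
- unfold pressure_primitive, Rdiv. field. lra.
- intros u Hu. now apply (smooth_on_continuous _ _ _ Hp).
Qed.

Lemma pressure_primitive_taylor (p : R -> R) (a b : R) :
  smooth_on (fun s => 0 < s) p -> 0 < a ->
  exists K, 0 < K /\ forall x y, a <= x <= b -> a <= y <= b ->
    Rabs (pressure_primitive p y - pressure_primitive p x - (y - x) * p (/ x))
    <= K * (y - x) ^ 2.
Proof.
intros Hp Ha.
apply (taylor1_remainder _ (fun y => p (/ y)) (fun y => - / y ^ 2 * Derive p (/ y))).
intros y Hy. assert (0 < y) by lra. split; [|split].
- now apply is_derive_pressure_primitive.
- now apply is_derive_pressure_Rinv.
- apply (continuous_mult (K := R_AbsRing)).
  + apply (ex_derive_continuous (K := R_AbsRing) (V := R_NormedModule)).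
    auto_derive. nra.
  + apply (continuous_comp Rinv (Derive p)).
    * apply continuous_Rinv. lra.
    * apply (smooth_on_continuous_Derive _ _ _ Hp). now apply Rinv_0_lt_compat.
Qed.

(** Put w = gx / rho0 and z = zx / rho0. On the closed box w lies in [m, Mw] and |z| <= B, so for
    |e| < d the perturbed w + e z stays in [m/2, Mw + m/2], where one Taylor constant K is valid.
    The kinetic part is an exact quadratic polynomial in e. *)
Lemma is_derive_action (p : R -> R) (s0 : R) (rho0 : R -> R)
    (gt gx zt zx : R -> R -> R) (x1 x2 a b t1 t2 : R) :
  smooth_on (fun s => 0 < s) p -> 0 < s0 ->
  (forall x, continuous rho0 x) -> (forall x, 0 < rho0 x) ->
  x1 <= x2 -> a < t1 -> t1 <= t2 -> t2 < b ->
  (forall x t, x1 <= x <= x2 -> a <= t <= b -> continuity_2d_pt gt x t) ->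
  (forall x t, x1 <= x <= x2 -> a <= t <= b -> continuity_2d_pt gx x t) ->
  (forall x t, x1 <= x <= x2 -> a <= t <= b -> 0 < gx x t) ->
  (forall x t, x1 <= x <= x2 -> a <= t <= b -> continuity_2d_pt zt x t) ->
  (forall x t, x1 <= x <= x2 -> a <= t <= b -> continuity_2d_pt zx x t) ->
  is_derive (fun e => action p s0 rho0 x1 x2 t1 t2
      (fun x t => gt x t + e * zt x t) (fun x t => gx x t + e * zx x t)) 0
    (RInt2 (fun x t => rho0 x * gt x t * zt x t + p (rho0 x / gx x t) * zx x t)
      x1 x2 t1 t2).
Proof.
intros Hp Hs Hrc Hr Hx Ha Ht Hb Cgt Cgx Pgx Czt Czx.
assert (Cr : forall x t, continuity_2d_pt (fun u _ => rho0 u) x t)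
  by (intros; now apply continuity_2d_pt_space).
assert (Cir : forall x t, continuity_2d_pt (fun u _ => / rho0 u) x t).
{ intros x t. apply continuity_2d_pt_inv; trivial. specialize (Hr x). lra. }
destruct (bounded_box (fun x t => gx x t * / rho0 x) x1 x2 a b) as [Mw [HMw Bw]].
{ intros. apply continuity_2d_pt_mult; auto. }
destruct (bounded_below_box (fun x t => gx x t * / rho0 x) x1 x2 a b) as [m [Hm Bm]].
{ intros. split. apply continuity_2d_pt_mult; auto.
  apply Rmult_lt_0_compat; auto. apply Rinv_0_lt_compat; auto. }
destruct (bounded_box (fun x t => zx x t * / rho0 x) x1 x2 a b) as [B [HB Bz]].
{ intros. apply continuity_2d_pt_mult; auto. }
destruct (bounded_box (fun x t => rho0 x) x1 x2 a b) as [N [HN BN]].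
{ auto. }
destruct (bounded_box (fun x t => / 2 * (rho0 x * (zt x t * zt x t))) x1 x2 a b)
  as [T [HT BT]].
{ intros. apply continuity_2d_pt_mult. apply continuity_2d_pt_const.
  apply continuity_2d_pt_mult; trivial. apply continuity_2d_pt_mult; auto. }
destruct (pressure_primitive_taylor p (m / 2) (Mw + m / 2) Hp) as [K [HK Htay]].
{ lra. }
(* Chosen so that d B = m / 2, the largest allowed shift of w. *)
set (d := m / (2 * B)).
assert (Hd : 0 < d) by (apply Rdiv_lt_0_compat; lra).
assert (W : forall e x t, Rabs e < d -> x1 <= x <= x2 -> a <= t <= b ->
  m <= gx x t * / rho0 x <= Mw /\
  m / 2 <= gx x t * / rho0 x + e * (zx x t * / rho0 x) <= Mw + m / 2).
{ intros e x t He Hx' Ht'.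
  assert (Hez : Rabs (e * (zx x t * / rho0 x)) <= m / 2).
  { rewrite Rabs_mult. replace (m / 2) with (d * B) by (unfold d; field; lra).
    apply Rmult_le_compat; try apply Rabs_pos. lra. now apply Bz. }
  apply Rabs_le_between in Hez.
  specialize (Bm x t Hx' Ht'). specialize (Bw x t Hx' Ht').
  apply Rabs_le_between in Bw. lra. }
set (H := fun e x t => / 2 * (rho0 x * ((gt x t + e * zt x t) * (gt x t + e * zt x t)))
    + rho0 x * (pressure_primitive p ((gx x t + e * zx x t) * / rho0 x)
                - pressure_primitive p (s0 * / rho0 x))).
(* The rewritten integrand agrees with the density only while gx + e zx > 0, hence only locally in
   e. *)
apply is_derive_ext_loc with (fun e => RInt2 (H e) x1 x2 t1 t2).
{ exists (mkposreal d Hd). intros e He.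
  unfold ball in He; simpl in He.
  unfold AbsRing_ball, abs, minus, plus, opp in He; simpl in He.
  rewrite Ropp_0, Rplus_0_r in He.
  apply RInt2_ext; trivial. intros x t Hx' Ht'.
  assert (Ht'' : a <= t <= b) by lra.
  destruct (W e x t He Hx' Ht'') as [_ [Wp _]].
  unfold H. rewrite density_pressure_primitive; trivial.
  specialize (Hr x).
  replace (gx x t + e * zx x t)
    with ((gx x t * / rho0 x + e * (zx x t * / rho0 x)) * rho0 x) by (field; lra).
  apply Rmult_lt_0_compat; lra. }
assert (CQ : forall y, 0 < y -> continuous (pressure_primitive p) y).
{ intros y Hy. apply (ex_derive_continuous (K := R_AbsRing) (V := R_NormedModule)).
  eexists. now apply is_derive_pressure_primitive. }
(* T bounds the coefficient of e^2 in the kinetic part; N bounds rho0, which multiplies a Taylor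
   remainder of size at most K (e z)^2. *)
apply is_derive_RInt2 with a b d (T + N * (K * B ^ 2)); trivial.
- intros e He x t Hx' Ht'. assert (Ht'' : a <= t <= b) by lra.
  assert (Cg : continuity_2d_pt (fun x t => gt x t + e * zt x t) x t).
  { apply continuity_2d_pt_plus; auto.
    apply continuity_2d_pt_mult; auto. apply continuity_2d_pt_const. }
  apply continuity_2d_pt_plus; apply continuity_2d_pt_mult; trivial.
  + apply continuity_2d_pt_const.
  + apply continuity_2d_pt_mult; trivial. apply continuity_2d_pt_mult; trivial.
  + apply continuity_2d_pt_minus.
    * apply continuity_2d_pt_comp.
      -- apply CQ. destruct (W e x t He Hx' Ht'') as [_ [Wp _]].
         replace ((gx x t + e * zx x t) * / rho0 x)
           with (gx x t * / rho0 x + e * (zx x t * / rho0 x)) by ring.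
         lra.
      -- apply continuity_2d_pt_mult; trivial. apply continuity_2d_pt_plus; auto.
         apply continuity_2d_pt_mult; auto. apply continuity_2d_pt_const.
    * apply continuity_2d_pt_comp.
      -- apply CQ. apply Rmult_lt_0_compat; trivial. now apply Rinv_0_lt_compat.
      -- apply continuity_2d_pt_mult; trivial. apply continuity_2d_pt_const.
- intros x t Hx' Ht'. assert (Ht'' : a <= t <= b) by lra.
  assert (Hgx := Pgx x t Hx' Ht'').
  apply continuity_2d_pt_plus; apply continuity_2d_pt_mult; auto.
  + apply continuity_2d_pt_mult; auto.
  + apply continuity_2d_pt_comp.
    * apply (smooth_on_continuous _ _ _ Hp). now apply Rdiv_lt_0_compat.
    * apply continuity_2d_pt_mult; trivial. apply continuity_2d_pt_inv; auto. lra.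
- intros e x t He Hx' Ht'. assert (Ht'' : a <= t <= b) by lra.
  assert (Hgx := Pgx x t Hx' Ht''). assert (Hrx := Hr x).
  destruct (W e x t He Hx' Ht'') as [W1 W2].
  set (w := gx x t * / rho0 x) in *. set (z := zx x t * / rho0 x) in *.
  (* The first-order terms match because rho0 z = zx; what is left is the square of the kinetic
     perturbation and rho0 times the Taylor remainder at w. *)
  assert (E : H e x t - H 0 x t
      - e * (rho0 x * gt x t * zt x t + p (rho0 x / gx x t) * zx x t)
    = / 2 * (rho0 x * (zt x t * zt x t)) * e ^ 2
      + rho0 x * (pressure_primitive p (w + e * z) - pressure_primitive p w
                   - (w + e * z - w) * p (/ w))).
  { unfold H.
    replace ((gx x t + e * zx x t) * / rho0 x) with (w + e * z) by (unfold w, z; ring).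
    replace ((gx x t + 0 * zx x t) * / rho0 x) with w by (unfold w; ring).
    replace (rho0 x / gx x t) with (/ w) by (unfold w; field; lra).
    unfold z; field. lra. }
  rewrite E. apply Rle_trans with (1 := Rabs_triang _ _).
  rewrite !Rabs_mult, <- Rabs_mult.
  rewrite Rmult_plus_distr_r. apply Rplus_le_compat.
  + rewrite (Rabs_pos_eq (e ^ 2)) by apply pow2_ge_0.
    apply Rmult_le_compat_r. apply pow2_ge_0.
    rewrite <- !Rabs_mult. now apply (BT x t).
  + rewrite !Rmult_assoc. apply Rmult_le_compat; try apply Rabs_pos.
    now apply (BN x t).
    apply Rle_trans with (K * (w + e * z - w) ^ 2).
    * apply Htay; lra.
    * replace (w + e * z - w) with (e * z) by ring.
      apply Rmult_le_compat_l. lra.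
      rewrite Rpow_mult_distr, Rmult_comm.
      apply Rmult_le_compat_r. apply pow2_ge_0.
      rewrite <- (pow2_abs z). apply pow_incr. split. apply Rabs_pos.
      now apply (Bz x t).
Qed.

(** * Integration by parts over a window *)

Lemma RInt2_derive_time (f ft : R -> R -> R) (x1 x2 a b t1 t2 : R) :
  x1 <= x2 -> a < t1 -> t1 <= t2 -> t2 < b ->
  (forall x t, a < t < b -> is_derive (fun s => f x s) t (ft x t)) ->
  (forall x t, a < t < b -> continuity_2d_pt f x t) ->
  (forall x t, a < t < b -> continuity_2d_pt ft x t) ->
  (forall x, f x t1 = f x t2) ->
  RInt2 ft x1 x2 t1 t2 = 0.
Proof.
intros Hx Ha Ht Hb D Cf Cft E.
assert (Bf : continuous_box f x1 x2 a b) by (intros x t _; apply Cf).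
assert (Bft : continuous_box ft x1 x2 a b) by (intros x t _; apply Cft).
assert (DW : forall t, a < t < b ->
  is_derive (fun s => RInt (fun x => f x s) x1 x2) t (RInt (fun x => ft x t) x1 x2)).
{ intros t Ht'.
  replace (RInt (fun x => ft x t) x1 x2)
    with (RInt (fun x => Derive (fun s => f x s) t) x1 x2).
  2: { apply RInt_ext. intros x _. now apply is_derive_unique, D. }
  apply (is_derive_RInt_param (fun s x => f x s)).
  - apply (locally_between _ a b); trivial. intros s Hs' x _. eexists. now apply D.
  - intros x _.
    apply (continuity_2d_pt_ext_loc (fun u v => ft v u)).
    + destruct (locally_between (fun s => a < s < b) a b t Ht' (fun _ h => h)) as [d Hd].
      exists d. intros u v Hu _. symmetry. apply is_derive_unique, D. now apply Hd.
    + now apply continuity_2d_pt_swap, Cft.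
  - apply (locally_between _ a b); trivial. intros s Hs'.
    now apply (ex_RInt_box f x1 x2 a b). }
unfold RInt2.
apply (is_RInt_unique (V := R_CompleteNormedModule)).
replace 0 with (minus (RInt (fun x => f x t2) x1 x2) (RInt (fun x => f x t1) x1 x2)).
- apply (is_RInt_derive (V := R_CompleteNormedModule)
    (fun s => RInt (fun x => f x s) x1 x2)).
  + intros t. rewrite Rmin_left, Rmax_right by trivial. intros Ht'. apply DW. lra.
  + intros t. rewrite Rmin_left, Rmax_right by trivial. intros Ht'.
    apply (continuous_RInt_box ft x1 x2 a b); trivial. lra.
- rewrite (RInt_ext (V := R_CompleteNormedModule) (fun x => f x t2) (fun x => f x t1)) by auto.
  apply Rminus_diag.
Qed.

(** Asking for equal rather than zero values at the two ends covers both spaces: on the circle the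
    flux is periodic, on the line it vanishes there. *)
Lemma RInt2_derive_space (f fx : R -> R -> R) (x1 x2 t1 t2 : R) :
  x1 <= x2 -> t1 <= t2 ->
  (forall x t, x1 <= x <= x2 -> t1 <= t <= t2 ->
    is_derive (fun y => f y t) x (fx x t)) ->
  (forall x t, x1 <= x <= x2 -> t1 <= t <= t2 -> continuity_2d_pt fx x t) ->
  (forall t, t1 <= t <= t2 -> f x1 t = f x2 t) ->
  RInt2 fx x1 x2 t1 t2 = 0.
Proof.
intros Hx Ht D C E. unfold RInt2.
rewrite (RInt_ext (V := R_CompleteNormedModule) _ (fun _ => 0)).
- rewrite RInt_const. apply Rmult_0_r.
- intros t. rewrite Rmin_left, Rmax_right by trivial. intros Ht'.
  apply (is_RInt_unique (V := R_CompleteNormedModule)).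
  replace 0 with (minus (f x2 t) (f x1 t)).
  + apply (is_RInt_derive (V := R_CompleteNormedModule) (fun x => f x t)).
    * intros x. rewrite Rmin_left, Rmax_right by trivial. intros Hx'. apply D; lra.
    * intros x. rewrite Rmin_left, Rmax_right by trivial. intros Hx'.
      apply continuous_2d_slice, C; lra.
  + rewrite E by lra. apply Rminus_diag.
Qed.

Definition euler_lagrange (p rho0 : R -> R) (gamma : R -> R -> R) (x t : R) : R :=
  rho0 x * dt (dt gamma) x t
  - Derive p (rho0 x / dx gamma x t) * (rho0 x / dx gamma x t ^ 2) * dx (dx gamma) x t
  + Derive p (rho0 x / dx gamma x t) * (Derive rho0 x / dx gamma x t).

Lemma continuous_adherent_zero (f : R -> R) (a : R) :
  continuous f a ->
  (forall eps : posreal, exists x, Rabs (x - a) < eps /\ f x = 0) -> f a = 0.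
Proof.
intros C H.
destruct (Req_dec (f a) 0) as [|N]; trivial.
assert (Hp : 0 < Rabs (f a)) by now apply Rabs_pos_lt.
destruct (proj1 (filterlim_locally _ _) C (mkposreal _ Hp)) as [d Hd].
destruct (H d) as [x [Hx E]].
specialize (Hd x Hx). unfold ball in Hd; simpl in Hd.
unfold AbsRing_ball, abs, minus, plus, opp in Hd; simpl in Hd.
rewrite E, Rplus_0_l, Rabs_Ropp in Hd. lra.
Qed.

Lemma continuous_zero_left (f : R -> R) (a : R) :
  continuous f a -> (forall x, x < a -> f x = 0) -> f a = 0.
Proof.
intros C H. apply continuous_adherent_zero; trivial. intros eps.
exists (a - eps / 2). pose proof (cond_pos eps). split.
- rewrite Rabs_left; lra.
- apply H; lra.
Qed.

Lemma continuous_zero_right (f : R -> R) (a : R) :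
  continuous f a -> (forall x, a < x -> f x = 0) -> f a = 0.
Proof.
intros C H. apply continuous_adherent_zero; trivial. intros eps.
exists (a + eps / 2). pose proof (cond_pos eps). split.
- rewrite Rabs_right; lra.
- apply H; lra.
Qed.

(** [supported_in] uses closed intervals and by itself says nothing at t1 and t2; the values there
    vanish as limits from outside. *)
Lemma supported_in_time_ends (M : space) (x1 x2 t1 t2 : R) (z : R -> R -> R) :
  (forall x t, continuity_2d_pt z x t) -> supported_in M x1 x2 t1 t2 z ->
  forall x, z x t1 = 0 /\ z x t2 = 0.
Proof.
intros C S x.
assert (Ct : forall t, continuous (fun s => z x s) t).
{ intros t. apply (continuous_2d_slice (fun u v => z v u)).
  now apply continuity_2d_pt_swap. }
assert (Z : forall t, t < t1 \/ t2 < t -> z x t = 0).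
{ intros t Ht. destruct (Req_dec (z x t) 0) as [|N]; trivial.
  destruct (S x t N). lra. }
split.
- apply (continuous_zero_left (fun s => z x s)); auto.
- apply (continuous_zero_right (fun s => z x s)); auto.
Qed.

(** A lift is not periodic, but a shift by L changes it only by a constant, which differentiation
    removes. *)
Lemma dx_diffeomorphism_circle (L : posreal) (gamma : R -> R -> R) (x t : R) :
  diffeomorphism (Circle L) (fun y => gamma y t) ->
  dx gamma (x + L) t = dx gamma x t.
Proof.
intros (Hm & Hd & _). simpl in Hm. unfold dx. symmetry.
apply is_derive_unique.
apply is_derive_ext with (fun y => gamma (y + L) t - L).
- intros y. rewrite Hm. apply Rplus_minus_r.
- assert (D : is_derive (fun y => gamma y t) (x + L) (Derive (fun y => gamma y t) (x + L))).
  { apply Derive_correct. exact (proj1 (Hd (x + L))). }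
  auto_derive.
  + eexists; exact D.
  + apply Rmult_1_l.
Qed.

(** This is the spatial boundary term. On the line both sides are zero, by continuity of z at the
    ends of its support; on the circle rho0, gamma_x and z each take the same value at x1 and x1 +
    L. *)
Lemma window_flux (M : space) (p rho0 : R -> R) (c : R) (gamma z : R -> R -> R)
    (x1 x2 t1 t2 : R) :
  function_on M rho0 ->
  (forall t, 0 < t < c -> diffeomorphism M (fun x => gamma x t)) ->
  (forall x t, continuity_2d_pt z x t) ->
  (forall t, function_on M (fun x => z x t)) ->
  window M c x1 x2 t1 t2 -> supported_in M x1 x2 t1 t2 z ->
  forall t, t1 <= t <= t2 ->
  p (rho0 x1 / dx gamma x1 t) * z x1 t = p (rho0 x2 / dx gamma x2 t) * z x2 t.
Proof.
intros Hr Hg C Hz (Ht1 & Ht2 & HM) S t Ht. destruct M as [|L].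
- assert (Z : forall x, x < x1 \/ x2 < x -> z x t = 0).
  { intros x Hx. destruct (Req_dec (z x t) 0) as [|N]; trivial.
    destruct (S x t N). lra. }
  assert (Cx : forall x, continuous (fun y => z y t) x).
  { intros x. now apply continuous_2d_slice. }
  rewrite (continuous_zero_left (fun y => z y t) x1) by auto.
  rewrite (continuous_zero_right (fun y => z y t) x2) by auto. ring.
- rewrite HM. simpl in Hr, Hz. rewrite Hr, Hz, dx_diffeomorphism_circle; trivial.
  apply Hg. lra.
Qed.

Lemma window_le (M : space) (c x1 x2 t1 t2 : R) :
  window M c x1 x2 t1 t2 -> x1 <= x2.
Proof.
intros (_ & _ & H). destruct M as [|L]. lra. pose proof (cond_pos L). lra.
Qed.

Lemma continuity_2d_euler_lagrange (p rho0 : R -> R) (c : R) (gamma : R -> R -> R)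
    (x t : R) :
  smooth_on (fun s => 0 < s) p ->
  smooth_on (fun _ => True) rho0 -> (forall x, 0 < rho0 x) ->
  class_C2_on_strip c gamma -> 0 < t < c -> 0 < dx gamma x t ->
  continuity_2d_pt (euler_lagrange p rho0 gamma) x t.
Proof.
intros Hp Hrs Hr Hg Ht Pg.
destruct (Hg x t Ht) as (_ & _ & _ & (Cgx & _ & _ & (Cgxx & _) & _)
  & (_ & _ & _ & _ & (Cgtt & _))).
change (continuity_2d_pt (dx gamma) x t) in Cgx.
change (continuity_2d_pt (dx (dx gamma)) x t) in Cgxx.
change (continuity_2d_pt (dt (dt gamma)) x t) in Cgtt.
assert (Cr : continuity_2d_pt (fun u _ => rho0 u) x t)
  by now apply continuity_2d_pt_space, (smooth_on_continuous _ _ _ Hrs).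
assert (Cdr : continuity_2d_pt (fun u _ => Derive rho0 u) x t)
  by now apply continuity_2d_pt_space, (smooth_on_continuous_Derive _ _ _ Hrs).
assert (Ci : continuity_2d_pt (fun u v => / dx gamma u v) x t)
  by (apply continuity_2d_pt_inv; trivial; lra).
assert (Ci2 : continuity_2d_pt (fun u v => / dx gamma u v ^ 2) x t).
{ apply continuity_2d_pt_inv; [|nra].
  repeat apply continuity_2d_pt_mult; trivial. apply continuity_2d_pt_const. }
assert (Cp : continuity_2d_pt (fun u v => Derive p (rho0 u / dx gamma u v)) x t).
{ apply continuity_2d_pt_comp.
  - apply (smooth_on_continuous_Derive _ _ _ Hp). now apply Rdiv_lt_0_compat.
  - now apply continuity_2d_pt_mult. }
unfold euler_lagrange.
apply continuity_2d_pt_plus; [apply continuity_2d_pt_minus|];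
  repeat apply continuity_2d_pt_mult; trivial.
Qed.

(** The first variation equals [At] + [Bx] minus the Euler-Lagrange expression times zeta, where
    [At] and [Bx] are exact derivatives in t and in x and integrate to zero over the window. *)
Lemma is_derive_action_euler_lagrange (M : space) (p rho0 : R -> R) (c s0 : R)
    (gamma zeta : R -> R -> R) (x1 x2 t1 t2 : R) :
  smooth_on (fun s => 0 < s) p -> function_on M rho0 ->
  smooth_on (fun _ => True) rho0 -> (forall x, 0 < rho0 x) -> 0 < s0 ->
  class_C2_on_strip c gamma ->
  (forall t, 0 < t < c -> diffeomorphism M (fun x => gamma x t)) ->
  (forall x t, 0 < t < c -> 0 < dx gamma x t) ->
  smooth2 zeta -> (forall t, function_on M (fun x => zeta x t)) ->
  window M c x1 x2 t1 t2 -> supported_in M x1 x2 t1 t2 zeta ->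
  is_derive (fun e => action p s0 rho0 x1 x2 t1 t2
      (fun x t => dt gamma x t + e * dt zeta x t)
      (fun x t => dx gamma x t + e * dx zeta x t)) 0
    (- RInt2 (fun x t => euler_lagrange p rho0 gamma x t * zeta x t) x1 x2 t1 t2).
Proof.
intros Hp HrM Hrs Hr Hs Hg Hd Pg Hz HzM HW HS.
assert (Hx := window_le _ _ _ _ _ _ HW).
destruct (HW) as ([Ht1 Ht12] & Ht2 & _).
assert (Cz : forall x t, continuity_2d_pt zeta x t) by (intros x t; apply (Hz 0%nat x t)).
assert (Czx : forall x t, continuity_2d_pt (dx zeta) x t)
  by (intros x t; destruct (Hz 1%nat x t) as (_ & _ & _ & [Q _] & _); exact Q).
assert (Czt : forall x t, continuity_2d_pt (dt zeta) x t)
  by (intros x t; destruct (Hz 1%nat x t) as (_ & _ & _ & _ & [Q _]); exact Q).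
assert (Cgx : forall x t, 0 < t < c -> continuity_2d_pt (dx gamma) x t)
  by (intros x t Ht; destruct (Hg x t Ht) as (_ & _ & _ & [Q _] & _); exact Q).
assert (Cgt : forall x t, 0 < t < c -> continuity_2d_pt (dt gamma) x t)
  by (intros x t Ht; destruct (Hg x t Ht) as (_ & _ & _ & _ & [Q _]); exact Q).
assert (Cgxx : forall x t, 0 < t < c -> continuity_2d_pt (dx (dx gamma)) x t)
  by (intros x t Ht; destruct (Hg x t Ht) as (_ & _ & _ & (_ & _ & _ & [Q _] & _) & _); exact Q).
assert (Cgtt : forall x t, 0 < t < c -> continuity_2d_pt (dt (dt gamma)) x t)
  by (intros x t Ht; destruct (Hg x t Ht) as (_ & _ & _ & _ & (_ & _ & _ & _ & [Q _])); exact Q).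
assert (Cr : forall x t, continuity_2d_pt (fun u _ => rho0 u) x t)
  by (intros; now apply continuity_2d_pt_space, (smooth_on_continuous _ _ _ Hrs)).
assert (Cdr : forall x t, continuity_2d_pt (fun u _ => Derive rho0 u) x t)
  by (intros; now apply continuity_2d_pt_space, (smooth_on_continuous_Derive _ _ _ Hrs)).
assert (CE : forall x t, 0 < t < c -> continuity_2d_pt (euler_lagrange p rho0 gamma) x t)
  by (intros; now apply continuity_2d_euler_lagrange with c; auto).
(* [Px] is the x-derivative of [P] by the chain and quotient rules; [At] is the t-derivative of rho0
   gamma_t zeta, and [Bx] the x-derivative of [P] zeta. *)
set (P := fun x t => p (rho0 x / dx gamma x t)).
set (Px := fun x t => Derive p (rho0 x / dx gamma x t)
  * ((Derive rho0 x * dx gamma x t - rho0 x * dx (dx gamma) x t) / dx gamma x t ^ 2)).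
set (At := fun x t => rho0 x * dt (dt gamma) x t * zeta x t
  + rho0 x * dt gamma x t * dt zeta x t).
set (Bx := fun x t => Px x t * zeta x t + P x t * dx zeta x t).
assert (Ci : forall x t, 0 < t < c -> continuity_2d_pt (fun u v => / dx gamma u v) x t).
{ intros x t Ht. specialize (Pg x t Ht). apply continuity_2d_pt_inv; auto. lra. }
assert (CP : forall x t, 0 < t < c -> continuity_2d_pt P x t).
{ intros x t Ht. apply continuity_2d_pt_comp.
  - apply (smooth_on_continuous _ _ _ Hp). apply Rdiv_lt_0_compat; auto.
  - apply continuity_2d_pt_mult; auto. }
assert (CPx : forall x t, 0 < t < c -> continuity_2d_pt Px x t).
{ intros x t Ht. assert (Pgx := Pg x t Ht). apply continuity_2d_pt_mult.
  - apply continuity_2d_pt_comp.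
    + apply (smooth_on_continuous_Derive _ _ _ Hp). apply Rdiv_lt_0_compat; auto.
    + apply continuity_2d_pt_mult; auto.
  - apply continuity_2d_pt_mult.
    + apply continuity_2d_pt_minus; apply continuity_2d_pt_mult; auto.
    + apply continuity_2d_pt_inv; [|nra].
      repeat apply continuity_2d_pt_mult; auto. apply continuity_2d_pt_const. }
assert (CA : forall x t, 0 < t < c -> continuity_2d_pt At x t).
{ intros x t Ht.
  apply continuity_2d_pt_plus; repeat apply continuity_2d_pt_mult; auto. }
assert (CB : forall x t, 0 < t < c -> continuity_2d_pt Bx x t).
{ intros x t Ht.
  apply continuity_2d_pt_plus; apply continuity_2d_pt_mult; auto. }
assert (IA : RInt2 At x1 x2 t1 t2 = 0).
{ apply (RInt2_derive_time (fun x t => rho0 x * dt gamma x t * zeta x t) _ _ _ 0 c);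
    trivial; try lra.
  - intros x t Ht.
    assert (D1 : is_derive (fun s => dt gamma x s) t (dt (dt gamma) x t)).
    { apply Derive_correct. destruct (Hg x t Ht) as (_ & _ & _ & _ & (_ & _ & Q & _)).
      exact Q. }
    assert (D2 : is_derive (fun s => zeta x s) t (dt zeta x t)).
    { apply Derive_correct. destruct (Hz 1%nat x t) as (_ & _ & Q & _). exact Q. }
    auto_derive.
    + repeat split; eexists; eassumption.
    + rewrite (is_derive_unique _ _ _ D1 : Derive (fun s : R => dt gamma x s) t = _).
      rewrite (is_derive_unique _ _ _ D2 : Derive (fun s : R => zeta x s) t = _).
      unfold At. ring.
  - intros x t Ht. repeat apply continuity_2d_pt_mult; auto.
  - intros x. destruct (supported_in_time_ends M x1 x2 t1 t2 zeta Cz HS x) as [-> ->].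
    ring. }
assert (IB : RInt2 Bx x1 x2 t1 t2 = 0).
{ apply (RInt2_derive_space (fun x t => P x t * zeta x t)); try lra.
  - intros x t Hx' Ht'. assert (Ht : 0 < t < c) by lra.
    assert (Pgx := Pg x t Ht).
    assert (D1 : is_derive (fun y => dx gamma y t) x (dx (dx gamma) x t)).
    { apply Derive_correct. destruct (Hg x t Ht) as (_ & _ & _ & (_ & Q & _) & _).
      exact Q. }
    assert (D2 : is_derive (fun y => zeta y t) x (dx zeta x t)).
    { apply Derive_correct. destruct (Hz 1%nat x t) as (_ & Q & _). exact Q. }
    assert (D3 := smooth_on_is_derive _ _ x Hrs I).
    assert (D4 : is_derive p (rho0 x / dx gamma x t) (Derive p (rho0 x / dx gamma x t))).
    { apply (smooth_on_is_derive _ _ _ Hp). apply Rdiv_lt_0_compat; auto. }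
    unfold P, Rdiv in *. auto_derive.
    + repeat split; try (eexists; eassumption). lra.
    + change (Derive (fun x0 => p x0)) with (Derive p).
      change (Derive (fun x0 => rho0 x0) x) with (Derive rho0 x).
      rewrite (is_derive_unique _ _ _ D1 : Derive (fun y : R => dx gamma y t) x = _).
      rewrite (is_derive_unique _ _ _ D2 : Derive (fun y : R => zeta y t) x = _).
      unfold Bx, Px, P, Rdiv. field. lra.
  - intros x t Hx' Ht'. apply CB. lra.
  - apply (window_flux M p rho0 c gamma zeta x1 x2 t1 t2); trivial. }
replace (- RInt2 (fun x t => euler_lagrange p rho0 gamma x t * zeta x t) x1 x2 t1 t2)
  with (RInt2 (fun x t => rho0 x * dt gamma x t * dt zeta x t
          + p (rho0 x / dx gamma x t) * dx zeta x t) x1 x2 t1 t2).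
(* The midpoints of 0 and t1 and of t2 and c bound a closed time interval around [t1, t2] that stays
   inside (0, c). *)
- apply (is_derive_action p s0 rho0 (dt gamma) (dx gamma) (dt zeta) (dx zeta)
    x1 x2 (t1 / 2) ((t2 + c) / 2) t1 t2); trivial; try lra.
  + intros x. now apply (smooth_on_continuous _ _ _ Hrs).
  + intros x t _ Ht. apply Cgt. lra.
  + intros x t _ Ht. apply Cgx. lra.
  + intros x t _ Ht. apply Pg. lra.
- assert (BB : forall f, (forall x t, 0 < t < c -> continuity_2d_pt f x t) ->
    continuous_box f x1 x2 0 c) by (intros f Hf x t _; apply Hf).
  assert (CEz : forall x t, 0 < t < c ->
    continuity_2d_pt (fun x t => euler_lagrange p rho0 gamma x t * zeta x t) x t).
  { intros x t Ht. apply continuity_2d_pt_mult; auto. }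
  rewrite (RInt2_ext _ (fun x t => At x t + 1 * Bx x t
    + -1 * (euler_lagrange p rho0 gamma x t * zeta x t))); trivial; try lra.
  + rewrite (RInt2_lin (fun x t => At x t + 1 * Bx x t) _ (-1) _ _ 0 c);
      trivial; try lra; auto using continuous_box_lin.
    rewrite (RInt2_lin At Bx 1 _ _ 0 c); trivial; try lra; auto.
  + intros x t _ Ht. unfold At, Bx, Px, P, euler_lagrange.
    assert (0 < dx gamma x t) by (apply Pg; lra).
    field. lra.
Qed.

(** * Test functions *)

(** Carrying the successive derivatives as witnesses lets sums, products and composites go through
    by induction on n, without computing iterated [Derive] terms. *)
Fixpoint differentiable_times (n : nat) (f : R -> R) : Prop :=
  match n with
  | 0%nat => True
  | S n => exists df, (forall x, is_derive f x (df x)) /\ differentiable_times n df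
  end.

Definition smooth (f : R -> R) : Prop := forall n, differentiable_times n f.

Lemma differentiable_times_pred (n : nat) (f : R -> R) :
  differentiable_times (S n) f -> differentiable_times n f.
Proof.
revert f. induction n as [|n IH]; intros f (df & H & Hn); simpl; trivial.
exists df. split; trivial. now apply IH.
Qed.

Lemma differentiable_times_plus (n : nat) (f g : R -> R) :
  differentiable_times n f -> differentiable_times n g ->
  differentiable_times n (fun x => f x + g x).
Proof.
revert f g. induction n as [|n IH]; intros f g; simpl; trivial.
intros (df & Hf & Hf') (dg & Hg & Hg').
exists (fun x => df x + dg x). split.
- intros x. now apply (is_derive_plus (K := R_AbsRing) (V := R_NormedModule) f g).
- now apply IH.
Qed.

Lemma differentiable_times_mult (n : nat) (f g : R -> R) :
  differentiable_times n f -> differentiable_times n g ->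
  differentiable_times n (fun x => f x * g x).
Proof.
revert f g. induction n as [|n IH]; intros f g; simpl; trivial.
intros Hf Hg.
assert (Hf0 := differentiable_times_pred n f Hf).
assert (Hg0 := differentiable_times_pred n g Hg).
destruct Hf as (df & Hf & Hf'). destruct Hg as (dg & Hg & Hg').
exists (fun x => df x * g x + f x * dg x). split.
- intros x. apply (is_derive_mult f g); trivial. intros; apply Rmult_comm.
- apply differentiable_times_plus; now apply IH.
Qed.

Lemma smooth_const (a : R) : smooth (fun _ => a).
Proof.
intros n. revert a. induction n as [|n IH]; intros a; simpl; trivial.
exists (fun _ => 0). split; trivial. intros x. apply (is_derive_const (K := R_AbsRing) (V := R_NormedModule)).
Qed.

Lemma smooth_id : smooth (fun x => x).
Proof.
intros [|n]; simpl; trivial. exists (fun _ => 1). split.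
- intros x. apply (is_derive_id (K := R_AbsRing)).
- apply smooth_const.
Qed.

Lemma smooth_plus (f g : R -> R) :
  smooth f -> smooth g -> smooth (fun x => f x + g x).
Proof. intros Hf Hg n. now apply differentiable_times_plus. Qed.

Lemma smooth_mult (f g : R -> R) :
  smooth f -> smooth g -> smooth (fun x => f x * g x).
Proof. intros Hf Hg n. now apply differentiable_times_mult. Qed.

Lemma smooth_comp (f g : R -> R) :
  smooth f -> smooth g -> smooth (fun x => f (g x)).
Proof.
assert (H : forall n f g, differentiable_times n f -> differentiable_times n g ->
  differentiable_times n (fun x => f (g x))).
{ clear f g. induction n as [|n IH]; intros f g; simpl; trivial.
  intros (df & Hf & Hf') Hg.
  assert (Hg0 := differentiable_times_pred n g Hg).
  destruct Hg as (dg & Hg & Hg').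
  exists (fun x => dg x * df (g x)). split.
  - intros x. now apply (is_derive_comp (K := R_AbsRing) (V := R_NormedModule) f g).
  - apply differentiable_times_mult; trivial. now apply IH. }
intros Hf Hg n. now apply H.
Qed.

Lemma smooth_cos : smooth cos.
Proof.
assert (H : forall n, differentiable_times n cos /\ differentiable_times n sin).
{ induction n as [|n [Hc Hs]]; simpl; auto. split.
  - exists (fun x => -1 * sin x). split.
    + intros x. auto_derive; trivial. ring.
    + apply differentiable_times_mult; trivial. apply smooth_const.
  - exists cos. split; trivial. intros x. auto_derive; trivial. ring. }
intros n. apply H.
Qed.

Lemma smooth2_prod (a b : R -> R) :
  smooth a -> smooth b -> smooth2 (fun x t => a x * b t).
Proof.
intros Ha Hb n x t.
(* One extra derivative of each factor is requested: it supplies the continuity of the partial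
   derivatives of top order n. *)
assert (H : forall n a b, differentiable_times (S n) a -> differentiable_times (S n) b ->
  ex_diff_n (fun x t => a x * b t) n x t).
{ clear. intros n. revert x t. induction n as [|n IH]; intros x t a b Ha Hb.
  - destruct Ha as (da & Ha & _). destruct Hb as (db & Hb & _). split; trivial.
    apply continuity_2d_pt_mult.
    + apply continuity_2d_pt_space.
      apply (ex_derive_continuous (K := R_AbsRing) (V := R_NormedModule)).
      eexists; apply Ha.
    + apply (continuity_2d_pt_comp b (fun _ v => v)).
      * apply (ex_derive_continuous (K := R_AbsRing) (V := R_NormedModule)).
        eexists; apply Hb.
      * apply continuity_2d_pt_id2.
  - assert (Ha0 := differentiable_times_pred _ _ Ha).
    assert (Hb0 := differentiable_times_pred _ _ Hb).
    assert (IH0 := IH x t a b Ha0 Hb0).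
    destruct Ha as (da & Ha & Ha'). destruct Hb as (db & Hb & Hb').
    assert (Dx : forall u v, is_derive (fun z => a z * b v) u (da u * b v)).
    { intros u v. apply (is_derive_scal_l (K := R_AbsRing) (V := R_NormedModule) a).
      apply Ha. }
    assert (Dt : forall u v, is_derive (fun z => a u * b z) v (a u * db v)).
    { intros u v. apply (is_derive_scal b). apply Hb. }
    split; [|split; [|split; [|split]]].
    + destruct n; apply IH0.
    + eexists; apply Dx.
    + eexists; apply Dt.
    + apply ex_diff_n_ext_loc with (fun u v => da u * b v).
      * exists (mkposreal 1 Rlt_0_1). intros u v _ _. symmetry.
        apply is_derive_unique, Dx.
      * now apply IH.
    + apply ex_diff_n_ext_loc with (fun u v => a u * db v).
      * exists (mkposreal 1 Rlt_0_1). intros u v _ _. symmetry.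
        apply is_derive_unique, Dt.
      * now apply IH. }
now apply H.
Qed.

(** The powers of 1 / x make the family closed under differentiation up to linear combinations, so
    that smoothness of all members follows by a single induction. *)
Definition flat (k : nat) (x : R) : R :=
  if Rlt_dec 0 x then (/ x) ^ k * exp (- / x) else 0.

Lemma flat_pos (k : nat) (x : R) : 0 < x -> flat k x = (/ x) ^ k * exp (- / x).
Proof. intros Hx. unfold flat. destruct (Rlt_dec 0 x); trivial. lra. Qed.

Lemma flat_npos (k : nat) (x : R) : x <= 0 -> flat k x = 0.
Proof. intros Hx. unfold flat. destruct (Rlt_dec 0 x); trivial. lra. Qed.

Lemma pow_div_fact_le_exp (y : R) (n : nat) :
  0 <= y -> y ^ n / INR (fact n) <= exp y.
Proof.
intros Hy. apply Rle_trans with (2 := exp_ge_taylor y n Hy).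
assert (T : forall k, 0 <= y ^ k / INR (fact k)).
{ intros k. apply Rmult_le_pos. now apply pow_le.
  apply Rlt_le, Rinv_0_lt_compat, INR_fact_lt_0. }
destruct n as [|n].
- apply Rle_refl.
- rewrite tech5. pose proof (cond_pos_sum _ n T). lra.
Qed.

(** With y = 1 / x > 0 the upper bound reads y^k <= k! exp y, a single term of the exponential
    series. *)
Lemma flat_bounds (k : nat) (x : R) : 0 <= flat k x <= INR (fact k).
Proof.
pose proof (INR_fact_lt_0 k) as Hf. destruct (Rlt_dec 0 x) as [Hx|Hx].
- rewrite flat_pos by trivial. assert (Hi := Rinv_0_lt_compat _ Hx).
  pose proof (exp_pos (- / x)) as He. split.
  + apply Rmult_le_pos; [apply pow_le|]; lra.
  + pose proof (pow_div_fact_le_exp (/ x) k (Rlt_le _ _ Hi)) as H.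
    apply Rmult_le_reg_r with (exp (/ x)). apply exp_pos.
    rewrite Rmult_assoc, <- exp_plus, Rplus_opp_l, exp_0, Rmult_1_r.
    apply Rmult_le_reg_r with (/ INR (fact k)). now apply Rinv_0_lt_compat.
    rewrite (Rmult_comm (INR _)), Rmult_assoc, Rinv_r, Rmult_1_r; lra.
- rewrite flat_npos by lra. lra.
Qed.

Lemma is_derive_flat (k : nat) (x : R) :
  is_derive (flat k) x (flat (S (S k)) x + - INR k * flat (S k) x).
Proof.
destruct (Rtotal_order x 0) as [Hx|[Hx|Hx]].
- rewrite !flat_npos by lra. rewrite Rmult_0_r, Rplus_0_r.
  apply is_derive_ext_loc with (fun _ => 0).
  + apply (locally_between _ (x - 1) 0). lra. intros s Hs.
    now rewrite flat_npos by lra.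
  + apply (is_derive_const (K := R_AbsRing) (V := R_NormedModule)).
(* At the origin, [flat k e] = e^2 [flat (S (S k)) e], and the last factor is at most (k + 2)!; the
   function is therefore its own quadratic remainder, with slope 0. *)
- subst x. rewrite !flat_npos by lra. rewrite Rmult_0_r, Rplus_0_r.
  apply is_derive_quadratic_remainder with 1 (INR (fact (S (S k)))). lra.
  intros e _. rewrite (flat_npos k 0), Rmult_0_r, !Rminus_0_r by lra.
  replace (flat k e) with (flat (S (S k)) e * e ^ 2).
  + rewrite Rabs_pos_eq.
    * apply Rmult_le_compat_r. apply pow2_ge_0. apply flat_bounds.
    * apply Rmult_le_pos. apply flat_bounds. apply pow2_ge_0.
  + destruct (Rlt_dec 0 e) as [He|He].
    * rewrite !flat_pos by trivial. simpl. field. lra.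
    * rewrite !flat_npos by lra. ring.
- rewrite !flat_pos by lra.
  apply is_derive_ext_loc with (fun x => (/ x) ^ k * exp (- / x)).
  + apply (locally_between _ 0 (x + 1)). lra. intros s Hs.
    now rewrite flat_pos by lra.
  + auto_derive. lra.
    destruct k as [|k]; simpl; field; lra.
Qed.

Lemma smooth_flat (k : nat) : smooth (flat k).
Proof.
intros n. revert k. induction n as [|n IH]; intros k; simpl; trivial.
exists (fun x => flat (S (S k)) x + - INR k * flat (S k) x). split.
- apply is_derive_flat.
- apply differentiable_times_plus; trivial.
  apply differentiable_times_mult; trivial. apply smooth_const.
Qed.

Lemma flat_gt_0 (k : nat) (x : R) : 0 < x -> 0 < flat k x.
Proof.
intros Hx. rewrite flat_pos by trivial. apply Rmult_lt_0_compat.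
- apply pow_lt. now apply Rinv_0_lt_compat.
- apply exp_pos.
Qed.

Lemma flat_neq_0 (k : nat) (x : R) : flat k x <> 0 -> 0 < x.
Proof.
intros H. apply Rnot_le_lt. intros Hx. now apply H, flat_npos.
Qed.

Lemma smooth_bump (x0 d : R) : 0 < d ->
  exists a, smooth a /\ (forall x, 0 <= a x) /\ 0 < a x0 /\
    forall x, a x <> 0 -> Rabs (x - x0) < d.
Proof.
(* The argument d^2 - (x - x0)^2 is positive exactly for |x - x0| < d; differences are spelled as
   sums to fit the closure lemmas. *)
intros Hd. exists (fun x => flat 0 (d * d + -1 * ((x + - x0) * (x + - x0)))).
split; [|split; [|split]].
- apply (smooth_comp (flat 0)). apply smooth_flat.
  assert (smooth (fun x => x + - x0)).
  { apply smooth_plus. apply smooth_id. apply smooth_const. }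
  apply smooth_plus. apply smooth_const.
  apply smooth_mult. apply smooth_const. now apply smooth_mult.
- intros x. apply flat_bounds.
- apply flat_gt_0. nra.
- intros x H. apply flat_neq_0 in H. apply Rabs_def1; nra.
Qed.

(* A bump on the circle is the flat function of [cos theta - cos eta], which is
   automatically periodic. *)
Lemma smooth_periodic_bump (L : posreal) (x0 d : R) : 0 < d ->
  exists a, smooth a /\ (forall x, a (x + L) = a x) /\ (forall x, 0 <= a x) /\
    0 < a x0 /\
    forall x, x0 - L / 2 <= x <= x0 + L / 2 -> a x <> 0 -> Rabs (x - x0) < d.
Proof.
intros Hd. assert (HL := cond_pos L). assert (HP := PI_RGT_0).
(* Capping at half a period keeps w d' <= PI, inside the interval [0, PI] on which the cosine
   decreases. *)
set (d' := Rmin d (L / 2)).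
assert (Hd' : 0 < d') by (apply Rmin_glb_lt; lra).
assert (Hd1 : d' <= d) by apply Rmin_l.
assert (Hd2 : d' <= L / 2) by apply Rmin_r.
set (w := 2 * PI / L).
assert (Hw : 0 < w) by (apply Rdiv_lt_0_compat; lra).
assert (HwL : w * (L / 2) = PI) by (unfold w; field; lra).
assert (Hwd : 0 < w * d' <= PI).
{ rewrite <- HwL. split. now apply Rmult_lt_0_compat.
  apply Rmult_le_compat_l; lra. }
exists (fun x => flat 0 (cos (w * (x + - x0)) + - cos (w * d'))).
split; [|split; [|split; [|split]]].
- apply (smooth_comp (flat 0)). apply smooth_flat.
  apply smooth_plus; [|apply smooth_const].
  apply (smooth_comp cos). apply smooth_cos.
  apply smooth_mult. apply smooth_const.
  apply smooth_plus. apply smooth_id. apply smooth_const.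
- intros x. replace (w * (x + L + - x0)) with (w * (x + - x0) + 2 * PI).
  + now rewrite cos_plus, cos_2PI, sin_2PI, Rmult_1_r, Rmult_0_r, Rminus_0_r.
  + rewrite <- HwL. field.
- intros x. apply flat_bounds.
- apply flat_gt_0. rewrite Rplus_opp_r, Rmult_0_r.
  pose proof (cos_decreasing_1 0 (w * d')). lra.
- intros x Hx H. apply flat_neq_0 in H. apply Rnot_le_lt. intros Hle.
  assert (Hax : Rabs (x - x0) <= L / 2) by (apply Rabs_le; lra).
  (* Evenness moves the argument into [0, PI], where |x - x0| >= d >= d' would force cos (w |x -
     x0|) <= cos (w d'). *)
  assert (E : cos (w * (x + - x0)) = cos (w * Rabs (x - x0))).
  { unfold Rabs. destruct (Rcase_abs (x - x0)).
    - rewrite <- cos_neg. f_equal. ring.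
    - reflexivity. }
  assert (Hd3 : w * d' <= w * Rabs (x - x0)) by (apply Rmult_le_compat_l; lra).
  assert (Hd4 : w * Rabs (x - x0) <= PI)
    by (rewrite <- HwL; apply Rmult_le_compat_l; lra).
  pose proof (cos_decr_1 (w * d') (w * Rabs (x - x0))). lra.
Qed.

(** A product of a bump in x and a bump in t. On the circle the window is the fundamental domain
    centred at x0, and closeness to x0 is claimed only inside it, since the periodic bump reappears
    around every translate of x0. *)
Lemma test_function (M : space) (c x0 t0 d : R) : 0 < t0 < c -> 0 < d ->
  exists zeta x1 x2 t1 t2,
    smooth2 zeta /\ (forall t, function_on M (fun x => zeta x t)) /\
    window M c x1 x2 t1 t2 /\ supported_in M x1 x2 t1 t2 zeta /\
    x1 < x0 < x2 /\ t1 < t0 < t2 /\ (forall x t, 0 <= zeta x t) /\ 0 < zeta x0 t0 /\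
    forall x t, x1 <= x <= x2 -> zeta x t <> 0 ->
      Rabs (x - x0) < d /\ Rabs (t - t0) < d.
Proof.
intros Ht Hd.
(* The two extra bounds keep [t0 - d', t0 + d'] inside (0, c). *)
set (d' := Rmin d (Rmin (t0 / 2) ((c - t0) / 2))).
assert (Hd' : 0 < d') by (repeat apply Rmin_glb_lt; lra).
assert (Hd1 : d' <= d) by apply Rmin_l.
assert (Hd2 : d' <= t0 / 2)
  by (apply Rle_trans with (1 := Rmin_r _ _); apply Rmin_l).
assert (Hd3 : d' <= (c - t0) / 2)
  by (apply Rle_trans with (1 := Rmin_r _ _); apply Rmin_r).
destruct (smooth_bump t0 d' Hd') as (b & Sb & Pb & Pb0 & Zb).
assert (Ha : exists a x1 x2, smooth a /\ function_on M a /\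
  (forall x, 0 <= a x) /\ 0 < a x0 /\ x1 < x0 < x2 /\
  match M with Line => x1 < x2 | Circle L => x2 = x1 + L end /\
  (forall x, a x <> 0 -> match M with Line => x1 <= x <= x2 | Circle _ => True end) /\
  forall x, x1 <= x <= x2 -> a x <> 0 -> Rabs (x - x0) < d).
{ destruct M as [|L].
  - destruct (smooth_bump x0 d Hd) as (a & Sa & Pa & Pa0 & Za).
    exists a, (x0 - d), (x0 + d).
    split; [|split; [|split; [|split; [|split; [|split; [|split]]]]]]; auto; try lra.
    + exact I.
    + intros x H. specialize (Za x H). apply Rabs_def2 in Za. lra.
  - destruct (smooth_periodic_bump L x0 d Hd) as (a & Sa & Ra & Pa & Pa0 & Za).
    pose proof (cond_pos L).
    exists a, (x0 - L / 2), (x0 + L / 2).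
    split; [|split; [|split; [|split; [|split; [|split; [|split]]]]]]; auto; lra. }
destruct Ha as (a & x1 & x2 & Sa & Ra & Pa & Pa0 & Hx0 & HM & Ma & Za).
assert (N : forall x t, a x * b t <> 0 -> a x <> 0 /\ b t <> 0).
{ intros x t H. split; intros E; apply H; rewrite E; ring. }
exists (fun x t => a x * b t), x1, x2, (t0 - d'), (t0 + d').
split; [|split; [|split; [|split; [|split; [|split; [|split; [|split]]]]]]];
  trivial; try lra.
- now apply smooth2_prod.
- intros t. destruct M as [|L]; [exact I|]. intros x. simpl in Ra |- *. now rewrite Ra.
- repeat split; trivial; lra.
- intros x t H. destruct (N x t H) as [N1 N2]. split.
  + specialize (Zb t N2). apply Rabs_def2 in Zb. lra.
  + exact (Ma x N1).
- intros x t. now apply Rmult_le_pos.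
- now apply Rmult_lt_0_compat.
- intros x t Hx H. destruct (N x t H) as [N1 N2]. split; auto.
  specialize (Zb t N2). lra.
Qed.

(** * The fundamental lemma *)

(** Continuity at m gives a subinterval [u, v] around m on which f > 0; the two outer pieces
    contribute nonnegatively. *)
Lemma RInt_gt_0_point (f : R -> R) (a m b : R) :
  a < m < b -> (forall x, a <= x <= b -> continuous f x) ->
  (forall x, a <= x <= b -> 0 <= f x) -> 0 < f m -> 0 < RInt f a b.
Proof.
intros Hm C P Pm.
assert (Cm : continuous f m) by (apply C; lra).
destruct (proj1 (filterlim_locally _ _) Cm (mkposreal _ Pm)) as [d Hd].
assert (Hdp := cond_pos d).
set (u := Rmax a (m - d / 2)). set (v := Rmin b (m + d / 2)).
assert (Hu : a <= u < m) by (split; [apply Rmax_l | apply Rmax_lub_lt; lra]).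
assert (Hu2 : m - d / 2 <= u) by apply Rmax_r.
assert (Hv : m < v <= b) by (split; [apply Rmin_glb_lt; lra | apply Rmin_l]).
assert (Hv2 : v <= m + d / 2) by apply Rmin_r.
assert (I : forall x y, a <= x -> x <= y -> y <= b -> ex_RInt f x y).
{ intros x y H1 H2 H3. apply ex_RInt_continuous_le; trivial.
  intros z Hz. apply C; lra. }
assert (E1 := RInt_Chasles (V := R_CompleteNormedModule) f a u v
  (I a u ltac:(lra) ltac:(lra) ltac:(lra)) (I u v ltac:(lra) ltac:(lra) ltac:(lra))).
assert (E2 := RInt_Chasles (V := R_CompleteNormedModule) f a v b
  (I a v ltac:(lra) ltac:(lra) ltac:(lra)) (I v b ltac:(lra) ltac:(lra) ltac:(lra))).
assert (P1 : 0 <= RInt f a u).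
{ apply RInt_ge_0. lra. apply I; lra. intros; apply P; lra. }
assert (P2 : 0 <= RInt f v b).
{ apply RInt_ge_0. lra. apply I; lra. intros; apply P; lra. }
assert (P3 : 0 < RInt f u v).
{ apply RInt_gt_0. lra.
  - intros x Hx. assert (B : ball m d x).
    { unfold ball; simpl. unfold AbsRing_ball, abs, minus, plus, opp; simpl.
      apply Rabs_def1; lra. }
    specialize (Hd x B). unfold ball in Hd; simpl in Hd.
    unfold AbsRing_ball, abs, minus, plus, opp in Hd; simpl in Hd.
    apply Rabs_def2 in Hd. lra.
  - intros x Hx. apply C; lra. }
unfold plus in E1, E2; simpl in E1, E2. lra.
Qed.

(** The one-variable statement is used twice: on the slice t = t0, and then on the inner integral as
    a function of t, which is positive at t0. *)
Lemma RInt2_gt_0_point (f : R -> R -> R) (x1 x0 x2 a b t1 t0 t2 : R) :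
  x1 < x0 < x2 -> a < t1 -> t1 < t0 < t2 -> t2 < b ->
  continuous_box f x1 x2 a b ->
  (forall x t, x1 <= x <= x2 -> t1 <= t <= t2 -> 0 <= f x t) -> 0 < f x0 t0 ->
  0 < RInt2 f x1 x2 t1 t2.
Proof.
intros Hx Ha Ht Hb C P P0.
apply RInt_gt_0_point with t0; trivial.
- intros t Ht'. apply (continuous_RInt_box f x1 x2 a b); trivial; lra.
- intros t Ht'. apply RInt_ge_0. lra.
  + apply (ex_RInt_box f x1 x2 a b); trivial; lra.
  + intros x Hx'. apply P; lra.
- apply RInt_gt_0_point with x0; trivial.
  + intros x Hx'. apply continuous_2d_slice, C; lra.
  + intros x Hx'. apply P; lra.
Qed.

(** * Equivalence of extremality and the diffeomorphism equation *)

Theorem mainTheorem3 (M : space) (p rho0 : R -> R) (c s0 : R)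
    (gamma : R -> R -> R)
    (p_smooth : smooth_on (fun s => 0 < s) p)
    (rho0_on_M : function_on M rho0)
    (rho0_smooth : smooth_on (fun _ => True) rho0)
    (rho0_pos : forall x, 0 < rho0 x)
    (c_pos : 0 < c)
    (s0_pos : 0 < s0)
    (gamma_C2 : class_C2_on_strip c gamma)
    (gamma_diffeo : forall t, 0 < t < c -> diffeomorphism M (fun x => gamma x t))
    (gamma_x_pos : forall x t, 0 < t < c -> 0 < dx gamma x t) :
  extremal M p s0 rho0 c gamma <-> diffeomorphism_equation p rho0 c gamma.
Proof.
split.
- intros Hext x0 t0 Ht0. change (euler_lagrange p rho0 gamma x0 t0 = 0).
  assert (CE : forall x t, 0 < t < c -> continuity_2d_pt (euler_lagrange p rho0 gamma) x t)
    by (intros; now apply continuity_2d_euler_lagrange with c; auto).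
  set (l := euler_lagrange p rho0 gamma x0 t0) in *.
  destruct (Req_dec l 0) as [|N]; trivial. exfalso.
  assert (Hl : 0 < Rabs l) by now apply Rabs_pos_lt.
  (* With tolerance |l|, the Euler-Lagrange expression keeps the sign of l within distance d of (x0,
     t0). *)
  destruct (CE x0 t0 Ht0 (mkposreal _ Hl)) as [d Hd]. simpl in Hd. fold l in Hd.
  destruct (test_function M c x0 t0 d Ht0 (cond_pos d))
    as (z & x1 & x2 & t1 & t2 & Sz & Mz & W & S & Hx & Ht & Pz & Pz0 & Zz).
  assert (D := is_derive_action_euler_lagrange M p rho0 c s0 gamma z x1 x2 t1 t2
    p_smooth rho0_on_M rho0_smooth rho0_pos s0_pos gamma_C2 gamma_diffeo gamma_x_pos
    Sz Mz W S).
  assert (D0 := Hext z Sz Mz x1 x2 t1 t2 W S).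
  (* Uniqueness of the derivative makes the integral of the Euler-Lagrange expression times z
     vanish. *)
  apply is_derive_unique in D, D0. rewrite D0 in D.
  destruct W as ([Ht1 Ht12] & Ht2 & _).
  set (g := fun x t => euler_lagrange p rho0 gamma x t * z x t) in *.
  assert (Cg : continuous_box g x1 x2 0 c).
  { intros x t _ Ht'. apply continuity_2d_pt_mult; auto. apply (Sz 0%nat). }
  (* The integrand is l g, written to fit [RInt2_lin]; the factor l makes it nonnegative for either
     sign of l, with value l^2 z > 0 at (x0, t0). *)
  assert (E : RInt2 (fun x t => g x t + (l - 1) * g x t) x1 x2 t1 t2 = 0).
  { rewrite (RInt2_lin g g (l - 1) _ _ 0 c); trivial; try lra.
    replace (RInt2 g x1 x2 t1 t2) with 0 by lra. ring. }
  apply (Rlt_irrefl 0). rewrite <- E at 2.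
  apply RInt2_gt_0_point with x0 0 c t0; trivial.
  + now apply continuous_box_lin.
  + intros x t Hx' Ht'.
    replace (g x t + (l - 1) * g x t)
      with (l * euler_lagrange p rho0 gamma x t * z x t) by (unfold g; ring).
    destruct (Req_dec (z x t) 0) as [->|Nz]. lra.
    destruct (Zz x t Hx' Nz) as [Dx Dt]. specialize (Hd x t Dx Dt).
    apply Rmult_le_pos; trivial.
    unfold Rabs at 2 in Hd. destruct (Rcase_abs l); apply Rabs_def2 in Hd; nra.
  + replace (g x0 t0 + (l - 1) * g x0 t0) with (l * l * z x0 t0) by (unfold g, l; ring).
    apply Rmult_lt_0_compat; trivial. nra.
- intros Heq z Sz Mz x1 x2 t1 t2 W S.
  assert (D := is_derive_action_euler_lagrange M p rho0 c s0 gamma z x1 x2 t1 t2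
    p_smooth rho0_on_M rho0_smooth rho0_pos s0_pos gamma_C2 gamma_diffeo gamma_x_pos
    Sz Mz W S).
  assert (Hx := window_le _ _ _ _ _ _ W). destruct W as ([Ht1 Ht12] & Ht2 & _).
  rewrite (RInt2_ext _ (fun _ _ => 0)) in D; trivial; try lra.
  + unfold RInt2 in D. rewrite !RInt_const in D.
    unfold scal in D; simpl in D; unfold mult in D; simpl in D.
    rewrite !Rmult_0_r, Ropp_0 in D. exact D.
  + intros x t _ Ht'.
    rewrite (Heq x t ltac:(lra) : euler_lagrange p rho0 gamma x t = 0). ring.
Qed.
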